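(* If $|\psi\rangle\in\mathcal{H}_2^{\otimes n}$ is a unit vector chosen uniformly at random under the Haar measure, then $\mathrm{TS}_{1/16}(|\psi\rangle)=2^{\Omega(n)}$ with probability $1-o(1)$ as $n\to\infty$. That is, there is a constant $c>0$ such that $\Pr_{|\psi\rangle}\left[\mathrm{TS}_{1/16}(|\psi\rangle)\ge 2^{cn}\right]\to 1$ as $n\to\infty$.
   Context: $\mathcal{H}_2=\mathbb{C}^2$ with basis $|0\rangle,|1\rangle$. A quantum state tree over $\mathcal{H}_2^{\otimes n}$ is a rooted tree in which each leaf is labeled with $\alpha|0\rangle+\beta|1\rangle$ for some $\alpha,\beta\in\mathbb{C}$, each non-leaf vertex (gate, of arbitrary fan-in) is labeled with $+$ or $\otimes$, and each vertex $v$ is labeled with a set $S(v)\subseteq\{1,\dots,n\}$ (of qubits) such that: (i) $|S(v)|=1$ if $v$ is a leaf; (ii) $S(v)=\{1,\dots,n\}$ if $v$ is the root; (iii) if $v$ is a $+$ gate and $w$ is a child of $v$ then $S(w)=S(v)$; (iv) if $v$ is a $\otimes$ gate with children $w_1,\dots,w_k$ then $S(w_1),\dots,S(w_k)$ form a partition of $S(v)$. The outgoing edges of each $+$ gate are labeled with complex numbers. The subtree at $v$ represents a state of the qubits in $S(v)$ in the obvious way (a $+$ gate gives the linear combination of its children with the edge labels as coefficients; a $\otimes$ gate gives the tensor product), and this state is required to be normalized for every $v$. The size of a tree is its number of leaves. $\mathrm{TS}(|\varphi\rangle)$ is the minimum size of a tree representing $|\varphi\rangle$, and $\mathrm{TS}_\varepsilon(|\psi\rangle)$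 is the minimum size of a tree representing a state $|\varphi\rangle$ such that $|\langle\psi|\varphi\rangle|^2\ge 1-\varepsilon$. *)

(* Defs.v *)
From HB Require Import structures.
From mathcomp Require Import all_boot all_order all_algebra.
From mathcomp Require Import spectral complex.
From mathcomp Require Import all_classical all_reals all_analysis.

Set Implicit Arguments.
Unset Strict Implicit.
Unset Printing Implicit Defensive.

Import Order.TTheory GRing.Theory Num.Theory.
Import numFieldNormedType.Exports.

Local Open Scope classical_set_scope.
Local Open Scope ring_scope.

Definition bits (n : nat) : finType := {ffun 'I_n -> bool}.

(* Coordinates are taken in the computational basis, the basis state |x> being
   indexed by [enum_rank x]. [dotmx] is conjugate-linear in its second argument,
   so that [dotmx psi phi] is <phi|psi>. *)
Definition qstate (R : realType) (n : nat) : Type := 'rV[R[i]]_#|bits n|.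

(* [R[i]^o] carries the topology of the complex modulus. *)
Definition qstate_borel (R : realType) (n : nat) :=
  g_sigma_algebraType (@open 'rV[(R[i])^o]_#|bits n|).

(* The uniform measure on the unit sphere, as a measure on the ambient space: it
   is the unique unitarily invariant Borel probability measure carried by the
   sphere. *)
Definition haar_measure (R : realType) (n : nat)
    (P : probability (qstate_borel R n) R) : Prop :=
  P [set psi | dotmx psi psi = 1] = 1%E /\
  forall U : 'M[R[i]]_#|bits n|, U \is unitarymx ->
  forall A : set (qstate_borel R n), measurable A ->
    P ((fun psi : qstate R n => psi *m U) @^-1` A) = P A.

Inductive qtree (C : Type) (n : nat) : Type :=
| Leaf of 'I_n & C & C
| Plus of {set 'I_n} & seq (C * qtree C n)
| Tensor of {set 'I_n} & seq (qtree C n).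

Section QTree.
Variables (C : numClosedFieldType) (n : nat).
Implicit Type t : qtree C n.

Definition qubits t : {set 'I_n} :=
  match t with Leaf i _ _ => [set i]%SET | Plus A _ => A | Tensor A _ => A end.

Fixpoint tree_size t : nat :=
  match t with
  | Leaf _ _ _ => 1
  | Plus _ cs => sumn [seq tree_size c.2 | c <- cs]
  | Tensor _ ts => sumn [seq tree_size c | c <- ts]
  end.

(* A state of the qubits in S, i.e. a family of amplitudes indexed by {0,1}^S, is
   encoded by the function that maps x : {0,1}^n to the amplitude of x|S; tensor
   product of states of disjoint sets of qubits is then pointwise product. *)
Fixpoint amplitude t (x : bits n) : C :=
  match t with
  | Leaf i alpha beta => if x i then beta else alpha
  | Plus _ cs => \sum_(a <- [seq c.1 * amplitude c.2 x | c <- cs]) a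
  | Tensor _ ts => \prod_(a <- [seq amplitude c x | c <- ts]) a
  end.

(* Each string on S is represented by its extension by 0 outside S. *)
Definition normalized t : bool :=
  \sum_(x : bits n | [forall i, x i ==> (i \in qubits t)])
     `|amplitude t x| ^+ 2 == 1.

Fixpoint valid t : bool :=
  normalized t &&
  match t with
  | Leaf _ _ _ => true
  | Plus A cs =>
      [&& (0 < size cs)%N, all (fun c => qubits c.2 == A) cs
        & all (fun c => valid c.2) cs]
  | Tensor A ts =>
      [&& (0 < size ts)%N, uniq [seq qubits c | c <- ts],
          finset.partition [set:: [seq qubits c | c <- ts]] A
        & all valid ts]
  end.

Definition quantum_state_tree t : bool := (qubits t == [set: 'I_n]%SET) && valid t.

Definition tree_state t : 'rV[C]_#|bits n| :=
  \row_j amplitude t (enum_val j).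

End QTree.

(* The infimum of a set of natural numbers is a minimum, unless no tree
   qualifies, which only happens for n = 0 when eps >= 0 and psi is a unit
   vector; its value is then +oo. *)
Definition TS (R : realType) (n : nat) (eps : R) (psi : qstate R n) : \bar R :=
  ereal_inf [set (tree_size t)%:R%:E | t in
    [set t : qtree R[i] n | quantum_state_tree t /\
      ((1 - eps)%:C)%C <= `|dotmx psi (tree_state t)| ^+ 2]].

(* Main.v *)
From HB Require Import structures.
Require Import Defs.
From mathcomp Require Import all_boot all_order all_algebra.
From mathcomp Require Import complex spectral.
From mathcomp Require Import all_classical all_reals all_analysis.
From mathcomp Require Import measurable_realfun.
From mathcomp Require Import ring lra zify.

(* Fix a degree D. For phi a tree state the function psi |-> <phi|psi>^D depends
   linearly on the D-th tensor power of phi, and the D-th tensor powers of all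
   states of trees with at most S leaves span a space of dimension M at most
   ((n + S) (D + 2))^(2S), whatever the labels are. In the space of dimension at
   most 2M spanned by the real and imaginary parts of these functions in L^2 of
   the Haar measure, the diagonal K of the reproducing kernel has integral at
   most 2M and satisfies
     |<phi|psi>|^(2D) <= K(psi) * E |<phi|.>|^(2D).
   By unitary invariance the last factor does not depend on the unit vector phi;
   averaging over the vectors with entries +-1/sqrt(2^n), Khinchine's inequality
   bounds it by 4 (8 e^2 D / 2^n)^D. Markov's inequality for K then bounds the
   probability that a tree with at most S leaves has fidelity at least 15/16
   with psi, and one takes S about 2^(n/8) and D about 2^(n/2). *)

Set Implicit Arguments.
Unset Strict Implicit.
Unset Printing Implicit Defensive.

Import Order.TTheory GRing.Theory Num.Theory.
Import numFieldNormedType.Exports.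

Local Open Scope classical_set_scope.
Local Open Scope ring_scope.

(** * Tensor rank of tree states *)

(** The states of small trees form a continuum, so there is nothing to count directly; the dimension
    of a span takes the place of a count. D has to be large against n S, so that M is at most 2^D,
    and small against 2^n, so that the moment divided by (15/16)^D is at most 4 * 4^-D; the product
    is then of order 2^-D. Averaging over sign vectors avoids computing Haar moments: once psi is
    fixed, only independent signs remain. A further obstacle is that identities in L^2 hold only
    almost everywhere, while the trees are uncountably many, so exceptional sets cannot be discarded
    one tree at a time. The kernel therefore comes with one function z >= 0 of integral 0, and the
    pointwise inequality is asserted for every phi of the family at each psi where z vanishes. The
    event that TS is large must also be shown measurable before its probability can be estimated
    through its complement. *)

Lemma qtree_ind_nested (C : Type) (n : nat) (Q : qtree C n -> Prop) :
  (forall i a b, Q (Leaf i a b)) ->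
  (forall A cs, foldr (fun c => and (Q c.2)) True cs -> Q (Plus A cs)) ->
  (forall A ts, foldr (fun t => and (Q t)) True ts -> Q (Tensor A ts)) ->
  forall t, Q t.
Proof.
move=> Ql Qp Qt; fix IH 1 => t; refine (match t with
  | Leaf i a b => Ql i a b
  | Plus A cs => Qp A cs ((fix aux cs :=
      match cs return foldr (fun c => and (Q c.2)) True cs with
      | [::] => I
      | c :: cs' => conj (IH c.2) (aux cs') end) cs)
  | Tensor A ts => Qt A ts ((fix aux ts :=
      match ts return foldr (fun t => and (Q t)) True ts with
      | [::] => I
      | c :: ts' => conj (IH c) (aux ts') end) ts)
  end).
Qed.

Section TensorRank.
Variables (C : comNzRingType) (X : Type) (D : nat).
Implicit Types (F G : (X -> C) -> Prop).

(* The span of the powers f^{\otimes k}, for f in F and k <= D, has dimension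
   at most r for each k. *)
Definition rank_le (r : nat) F := exists (I : finType) (w : I -> seq X -> C),
  (#|I| <= r)%N /\ forall f, F f -> exists c : nat -> I -> C, forall xs,
    (size xs <= D)%N -> \prod_(x <- xs) f x = \sum_i c (size xs) i * w i xs.

Lemma rank_leW r s F G : (r <= s)%N -> (forall f, F f -> G f) ->
  rank_le r G -> rank_le s F.
Proof.
move=> rs FG [I [w [Ir wP]]]; exists I, w; split; first exact: leq_trans rs.
by move=> f /FG /wP.
Qed.

Lemma rank_leU r s F G : rank_le r F -> rank_le s G ->
  rank_le (r + s) (fun f => F f \/ G f).
Proof.
move=> [I [w [Ir wP]]] [J [v [Js vP]]].
exists (I + J)%type, (fun k xs => match k with inl i => w i xs | inr j => v j xs end).
split; first by rewrite card_sum leq_add.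
move=> f [/wP|/vP] [c cP].
- exists (fun m k => match k with inl i => c m i | inr _ => 0 end) => xs /cP ->.
  rewrite big_sumType /= [X in _ + X]big1 ?addr0// => j _.
  by rewrite mul0r.
- exists (fun m k => match k with inl _ => 0 | inr i => c m i end) => xs /cP ->.
  rewrite big_sumType /= [X in X + _]big1 ?add0r// => j _.
  by rewrite mul0r.
Qed.

Lemma rank_le_bigU m r (F : nat -> (X -> C) -> Prop) :
  (forall a, (a < m)%N -> rank_le r (F a)) ->
  rank_le (m * r) (fun f => exists2 a, (a < m)%N & F a f).
Proof.
elim: m => [_|m IH rF].
  by exists void, (fun=> fun=> 0); split; [rewrite card_void|move=> f []].
apply: rank_leW (rank_leU (rF m (ltnSn m)) (IH _)).
- by rewrite mulSn.
- move=> f [a]; rewrite ltnS leq_eqVlt => /orP[/eqP ->|am] Ff; first by left.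
  by right; exists a.
- by move=> a am; apply: rF; exact: ltnW.
Qed.

(** Powers of a pointwise product are products of the powers, so the products of the two spanning
    families suffice. *)
Lemma rank_leM r s F G : rank_le r F -> rank_le s G ->
  rank_le (r * s) (fun h => exists f g, [/\ F f, G g & h = fun x => f x * g x]).
Proof.
move=> [I [w [Ir wP]]] [J [v [Js vP]]].
exists (I * J)%type, (fun k xs => w k.1 xs * v k.2 xs).
split; first by rewrite card_prod leq_mul.
move=> h [f [g [/wP[c cP] /vP[d dP] ->]]].
exists (fun m k => c m k.1 * d m k.2) => xs sxs.
rewrite big_split /= cP// dP// big_distrlr pair_big /=.
by apply: eq_bigr => -[i j] _ /=; rewrite mulrACA.
Qed.

Lemma prod_add_mask (f g : X -> C) (xs : seq X) :
  \prod_(x <- xs) (f x + g x) =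
  \sum_(m : (size xs).-tuple bool)
    \prod_(x <- mask m xs) f x * \prod_(x <- mask (map negb m) xs) g x.
Proof.
elim: xs => [|x xs IH].
  rewrite big_nil (eq_bigr (fun=> 1)) => [|m _].
    by rewrite sumr_const card_tuple expn0.
  by rewrite (tuple0 m) /= !big_nil mulr1.
rewrite big_cons IH /=.
rewrite (reindex (fun p : bool * (size xs).-tuple bool =>
  [tuple of p.1 :: p.2])) /=; last first.
  exists (fun m : (size xs).+1.-tuple bool => (thead m, [tuple of behead m])).
  - by move=> -[b m] _; congr pair; apply/val_inj.
  - by move=> m _; rewrite [m in RHS]tuple_eta.
rewrite -(pair_bigA _ (fun (b : bool) (m : (size xs).-tuple bool) =>
   \prod_(y <- mask (b :: m) (x :: xs)) f y *
   \prod_(y <- mask (~~ b :: map negb m) (x :: xs)) g y)) /=.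
rewrite big_bool /= mulrDl; congr (_ + _).
- rewrite big_distrr /=; apply: eq_bigr => m _.
  by rewrite big_cons mulrA.
- rewrite big_distrr /=; apply: eq_bigr => m _.
  by rewrite big_cons mulrCA.
Qed.

(** In the expansion of the k-th power of f + g, group the masks by the number j of factors taken
    from f. All masks of a group share the coefficients of f at length j and of g at length k - j,
    so a group contributes one spanning function per pair of indices. This gives the factor D + 1
    instead of 2^D, and explains why [rank_le] treats all lengths up to D at once, with coefficients
    depending on the length. *)
Lemma rank_leD r s F G : rank_le r F -> rank_le s G ->
  rank_le (D.+1 * (r * s))
    (fun h => exists f g, [/\ F f, G g & h = fun x => f x + g x]).
Proof.
move=> [I [w [Ir wP]]] [J [v [Js vP]]].
exists ('I_D.+1 * (I * J))%type, (fun (k : 'I_D.+1 * (I * J)) xs =>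
  \sum_(m : (size xs).-tuple bool | count id m == k.1 :> nat)
    w k.2.1 (mask m xs) * v k.2.2 (mask (map negb m) xs)).
split; first by rewrite !card_prod card_ord leq_mul// leq_mul.
move=> h [f [g [/wP[c cP] /vP[d dP] ->]]].
exists (fun m (k : 'I_D.+1 * (I * J)) => c k.1 k.2.1 * d (m - k.1)%N k.2.2) => xs sxs.
rewrite prod_add_mask.
rewrite (partition_big (fun m : (size xs).-tuple bool => inord (count id m) : 'I_D.+1)
           predT) //=.
rewrite -[RHS](pair_bigA _ (fun (k : 'I_D.+1) (p : I * J) =>
   c k p.1 * d (size xs - k)%N p.2 *
   \sum_(m : (size xs).-tuple bool | count id m == k :> nat)
    w p.1 (mask m xs) * v p.2 (mask (map negb m) xs))) /=.
apply: eq_bigr => k _.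
under [RHS]eq_bigr do rewrite big_distrr /=.
rewrite exchange_big /=.
have cnt (m : (size xs).-tuple bool) : (count id m < D.+1)%N.
  by rewrite ltnS (leq_trans (count_size _ _))// size_tuple.
apply: eq_big => [m|m /eqP <-].
  by apply/eqP/eqP => [<-|->]; rewrite ?inordK// inord_val.
have s1 : size (mask m xs) = count id m by rewrite size_mask// size_tuple.
have s2 : size (mask (map negb m) xs) = (size xs - count id m)%N.
  rewrite size_mask ?size_map ?size_tuple// count_map.
  by rewrite -[X in (X - _)%N](size_tuple m) -(count_predC id m) addKn.
rewrite cP; last by rewrite s1 -ltnS.
rewrite dP; last by rewrite s2 (leq_trans (leq_subr _ _)).
rewrite s1 s2 big_distrlr pair_big /= inordK//; apply: eq_bigr => -[i j] _ /=.
by rewrite mulrACA.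
Qed.

(** The power is b^j a^(k - j), where j counts the entries satisfying p; the indicators of the
    values of j span. *)
Lemma rank_le_if (p : X -> bool) :
  rank_le D.+1 (fun f => exists a b, f = fun x => if p x then b else a).
Proof.
exists 'I_D.+1, (fun (k : 'I_D.+1) xs => (count p xs == k)%:R).
split; first by rewrite card_ord.
move=> f [a [b ->]]; exists (fun m (k : 'I_D.+1) => b ^+ k * a ^+ (m - k)) => xs sxs.
have cnt : (count p xs < D.+1)%N by rewrite ltnS (leq_trans (count_size _ _)).
rewrite (bigD1 (Ordinal cnt)) //= eqxx mulr1 [X in _ + X]big1 ?addr0; last first.
  move=> k; rewrite -val_eqE /= eq_sym => /negbTE ->.
  by rewrite mulr0.
elim: xs {sxs cnt} => [|x xs IH]; first by rewrite big_nil mulr1.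
rewrite big_cons IH /=; case: (p x) => /=.
- by rewrite add1n subSS exprS mulrA.
- by rewrite add0n mulrCA -exprS subSn// count_size.
Qed.

End TensorRank.

(** * Arithmetic formulas of fan-in two *)

Section Formula.
Variables (C : comNzRingType) (n : nat).

(** The index is the number of leaves. Qubit sets and normalization are forgotten; what remains is
    sums and products of functions of one bit, to which the rank bounds apply. *)
Inductive formula : nat -> (bits n -> C) -> Prop :=
| formula_leaf i a b : formula 1 (fun x => if x i then b else a)
| formula_add s t f g :
    formula s f -> formula t g -> formula (s + t) (fun x => f x + g x)
| formula_mul s t f g :
    formula s f -> formula t g -> formula (s + t) (fun x => f x * g x).

Lemma formula_gt0 s f : formula s f -> (0 < s)%N.
Proof. by elim=> // s1 t1 *; rewrite addn_gt0; apply/orP; left. Qed.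

(** The scalar is pushed into both terms of a sum, into one factor of a product, and finally into
    leaf labels. Edge labels of a [Plus] gate thus cost no leaves. *)
Lemma formula_scale s f (c : C) : formula s f -> formula s (fun x => c * f x).
Proof.
elim=> [i a b|{}s t {}f g _ IHf _ IHg|{}s t {}f g _ IHf hg _].
- rewrite [X in formula _ X](_ : _ = fun x : bits n => if x i then c * b else c * a).
    exact: formula_leaf.
  by apply/funext => x; case: ifP.
- rewrite [X in formula _ X](_ : _ = fun x : bits n => c * f x + c * g x).
    exact: formula_add.
  by apply/funext => x; rewrite mulrDr.
- rewrite [X in formula _ X](_ : _ = fun x : bits n => c * f x * g x).
    exact: formula_mul.
  by apply/funext => x; rewrite mulrA.
Qed.

Lemma formula_inv s h : formula s h ->
  (s = 1%N /\ exists (i : 'I_n) a b, h = fun x : bits n => if x i then b else a) \/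
  exists a b f g, [/\ s = (a + b)%N, formula a f, formula b g &
    h = (fun x => f x + g x) \/ h = (fun x => f x * g x)].
Proof.
case=> [i a b|a b f g hf hg|a b f g hf hg]; first by left; split=> //; exists i, a, b.
- by right; exists a, b, f, g; split=> //; left.
- by right; exists a, b, f, g; split=> //; right.
Qed.

(** Write B for the base. For s = a + b the exponents 2a - 1 and 2b - 1 add up to 2s - 2, so each
    gate has one spare factor B: n + S covers the choice of a, and D + 2 is D + 1 for a sum plus 1
    for a product. A leaf needs n (D + 1), also at most B. *)
Lemma formula_rank (D S s : nat) : (0 < s <= S)%N ->
  rank_le D (((n + S) * D.+2) ^ (s.*2.-1)) (formula s).
Proof.
set B := ((n + S) * D.+2)%N.
elim/ltn_ind: s => s IH /andP[s0 sS].
case: (ltnP 1 s) => [s1|s1]; last first.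
  have -> : s = 1%N by apply/eqP; rewrite eqn_leq s1 s0.
  apply: (@rank_leW _ _ _ (n * D.+1) _ _ (fun f => exists2 a, (a < n)%N &
    exists2 i : 'I_n, i = a :> nat &
       exists a b, f = fun x : bits n => if x i then b else a)).
  - by rewrite /= expn1 leq_mul// leq_addr.
  - move=> f /formula_inv[[_ [i fE]]|[a [b [f1 [f2 [ab]]]]]].
      by exists i => //; exists i.
    by move=> /formula_gt0 a0 /formula_gt0 b0; lia.
  - apply: rank_le_bigU => a an.
    apply: rank_leW (leqnn _) _ (@rank_le_if C _ D (fun x : bits n => x (Ordinal an))).
    move=> f [i ia [u [v ->]]]; exists u, v.
    by have -> : Ordinal an = i by apply/val_inj.
apply: (@rank_leW _ _ _ (s * (D.+2 * B ^ (s.*2.-2))) _ _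
   (fun h => exists2 a, (a < s)%N & (0 < a)%N /\
     ((exists f g, [/\ formula a f, formula (s - a) g & h = fun x => f x + g x])
     \/ (exists f g, [/\ formula a f, formula (s - a) g & h = fun x => f x * g x])))).
- rewrite mulnA [s.*2.-1](_ : _ = s.*2.-2.+1); last by lia.
  by rewrite expnS leq_mul2r /B leq_mul ?orbT// (leq_trans sS)// leq_addl.
- move=> h /formula_inv[[sE _]|[a [b [f [g [sE hf hg hE]]]]]]; first by lia.
  have := formula_gt0 hf; have := formula_gt0 hg; exists a; first by lia.
  split; first by lia.
  by rewrite sE addKn; case: hE => ->; [left|right]; exists f, g.
- apply: rank_le_bigU => -[|a] as_.
    (* At a = 0 the family is empty, as its members require [0 < a]. *)
    exists void, (fun=> fun=> 0); split; first by rewrite card_void.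
    by move=> f [].
  have r1 := IH a.+1 as_ _; have r2 := IH (s - a.+1)%N _ _.
  have ra : rank_le D (B ^ (a.+1.*2.-1)) (formula a.+1) by apply: r1; lia.
  have rb : rank_le D (B ^ ((s - a.+1).*2.-1)) (formula (s - a.+1)).
    by apply: r2; lia.
  apply: rank_leW (rank_leU (rank_leD ra rb) (rank_leM ra rb)).
  + rewrite -expnD (_ : a.+1.*2.-1 + _ = s.*2.-2)%N; last by lia.
    by rewrite addnC -mulSn.
  + by move=> f [].
Qed.

End Formula.

(** A gate of large fan-in unrolls into binary gates on the same leaves. Validity excludes gates
    without children, whose size would be 0. *)
Lemma formula_amplitude (C : numClosedFieldType) (n : nat) (t : qtree C n) :
  valid t -> formula (tree_size t) (amplitude t).
Proof.
elim/qtree_ind_nested: t => [i a b _|A cs + /andP[_ /and3P[cs0 _ csv]]|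
                             A ts + /andP[_ /and4P[ts0 _ _ tsv]]].
- exact: formula_leaf.
- elim: cs cs0 csv => // c [|d cs] IH _ /= /andP[vc vcs] [Fc Fcs].
    rewrite addn0 [X in formula _ X](_ : _ = fun x : bits n => c.1 * amplitude c.2 x).
      exact/formula_scale/Fc.
    by apply/funext => x /=; rewrite big_seq1.
  rewrite [X in formula _ X](_ : _ = fun x : bits n => c.1 * amplitude c.2 x +
      amplitude (Plus A (d :: cs)) x).
    by apply: formula_add; [exact/formula_scale/Fc|exact: IH].
  by apply/funext => x /=; rewrite big_cons.
- elim: ts ts0 tsv => // c [|d ts] IH _ /= /andP[vc vts] [Fc Fts].
    rewrite addn0 [X in formula _ X](_ : _ = amplitude c).
      exact: Fc.
    by apply/funext => x /=; rewrite big_seq1.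
  rewrite [X in formula _ X](_ : _ = fun x : bits n => amplitude c x *
      amplitude (Tensor A (d :: ts)) x).
    by apply: formula_mul; [exact: Fc|exact: IH].
  by apply/funext => x /=; rewrite big_cons.
Qed.

(** * Khinchine's inequality *)

Section Khinchine.
Variable R : realType.
Implicit Types (x t a : R).

Lemma expR_ge_expn (k : nat) t : (0 < k)%N -> 0 <= t -> (t / k%:R) ^+ k <= expR t.
Proof.
move=> k0 t0; have kp : 0 < k%:R :> R by rewrite ltr0n.
rewrite -[X in expR X](divfK (lt0r_neq0 kp)) expRM_natr.
apply: lerXn2r; rewrite ?nnegrE ?divr_ge0 ?expR_ge0 ?ler0n//.
by apply: le_trans (expR_ge1Dx _); rewrite lerDr.
Qed.

(** The sharp exponent would be x^2 / 2. The weaker 2 x^2 allows an elementary proof: it dominates x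
    from 1/2 on, and below 1/2 the bounds e^x <= 1 / (1 - x) and e^-x <= 1 / (1 + x) suffice. *)
Lemma cosh_le_gauss x : expR x + expR (- x) <= 2 * expR (2 * x ^+ 2).
Proof.
wlog x0 : x / 0 <= x.
  move=> H; case: (leP 0 x) => [/H //|/ltW x0].
  by have := H (- x); rewrite oppr_ge0 opprK sqrrN addrC; exact.
have [x1|x1] := leP (1 / 2) x.
  have h : x <= 2 * x ^+ 2 by nra.
  have : expR x <= expR (2 * x ^+ 2) by rewrite ler_expR.
  have : expR (- x) <= expR (2 * x ^+ 2) by rewrite ler_expR; lra.
  lra.
(* 1 / (1 - x) + 1 / (1 + x) = 2 / (1 - x^2) <= 2 (1 + 2 x^2) *)
have h1 : expR x * (1 - x) <= 1.
  rewrite -[leRHS](expRxMexpNx_1 x) ler_pM2l ?expR_gt0//.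
  exact: expR_ge1Dx.
have h2 : expR (- x) * (1 + x) <= 1.
  rewrite -[leRHS](expRxMexpNx_1 x) mulrC ler_pM2r ?expR_gt0//.
  exact: expR_ge1Dx.
have h3 : 1 + 2 * x ^+ 2 <= expR (2 * x ^+ 2) by exact: expR_ge1Dx.
have h1' : expR x <= (1 - x)^-1 by rewrite -[leRHS]mul1r ler_pdivlMr//; lra.
have h2' : expR (- x) <= (1 + x)^-1 by rewrite -[leRHS]mul1r ler_pdivlMr//; lra.
suff : (1 - x)^-1 + (1 + x)^-1 <= 2 * (1 + 2 * x ^+ 2) by lra.
have -> : (1 - x)^-1 + (1 + x)^-1 = 2 / (1 - x ^+ 2).
  by field; rewrite !lt0r_neq0//=; nra.
have y1 : x ^+ 2 <= 1 / 4 by nra.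
have y0 : 0 <= x ^+ 2 by exact: sqr_ge0.
move: (x ^+ 2) y0 y1 => y y0 y1.
by rewrite ler_pdivrMr; nra.
Qed.

Definition rademacher N (s : {ffun 'I_N -> bool}) (a : 'I_N -> R) : R :=
  \sum_j (-1) ^+ s j * a j.

Lemma sum_expR_rademacher N (a : 'I_N -> R) :
  \sum_s expR (rademacher s a) = \prod_j (expR (a j) + expR (- a j)).
Proof.
rewrite [RHS](eq_bigr (fun j => \sum_(b : bool) expR ((-1) ^+ b * a j))); last first.
  by move=> j _; rewrite big_bool /= expr0 expr1 mul1r mulN1r addrC.
rewrite bigA_distr_bigA /=; apply: eq_bigr => s _.
by rewrite /rademacher expR_sum.
Qed.

Lemma sum_expR_rademacher_le N (a : 'I_N -> R) :
  \sum_s expR (rademacher s a) <= 2 ^+ N * expR (2 * \sum_j a j ^+ 2).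
Proof.
rewrite sum_expR_rademacher mulr_sumr expR_sum.
rewrite -[X in 2 ^+ X](card_ord N) -prodr_const -big_split /=.
apply: ler_prod => j _; rewrite addr_ge0 ?expR_ge0//=.
exact: cosh_le_gauss.
Qed.

(** Moments are bounded by exponential moments: (l|x| / 2D)^(2D) <= e^(l|x|) <= e^(lx) + e^(-lx).
    With l^2 = D the prefactor (2D / l)^(2D) is (4D)^D, and each exponential averages to at most
    e^(2 l^2) = e^(2D). *)
Lemma khinchine N D (a : 'I_N -> R) : (0 < D)%N -> \sum_j a j ^+ 2 <= 1 ->
  \sum_s (rademacher s a ^+ 2) ^+ D <=
  2 ^+ N * (2 * ((4 * D%:R) ^+ D * expR (2 * D%:R))).
Proof.
move=> D0 a1; have Dp : 0 < D%:R :> R by rewrite ltr0n.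
pose l := Num.sqrt (D%:R : R).
have l2 : l ^+ 2 = D%:R by rewrite sqr_sqrtr// ltW.
have bnd (x : R) : (x ^+ 2) ^+ D <= (4 * D%:R) ^+ D * (expR (l * x) + expR (l * - x)).
  have H : (x ^+ 2) ^+ D <= (4 * D%:R) ^+ D * expR (l * `|x|).
    have h := @expR_ge_expn (2 * D) (l * `|x|) _ _.
    rewrite mulrC -ler_pdivrMr ?exprn_gt0 ?mulr_gt0// -expr_div_n.
    rewrite (le_trans _ (h _ _)) ?muln_gt0// ?mulr_ge0// ?sqrtr_ge0//.
    rewrite exprM; apply: lerXn2r.
    - by rewrite nnegrE divr_ge0 ?sqr_ge0// mulr_ge0.
    - by rewrite nnegrE sqr_ge0.
    rewrite expr_div_n exprMn l2 real_normK ?num_real// natrM.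
    by rewrite le_eqVlt; apply/orP; left; apply/eqP; field; rewrite gt_eqF.
  apply: le_trans H _; rewrite ler_pM2l ?exprn_gt0 ?mulr_gt0//.
  by case: ger0P => _; rewrite ?lerDl ?lerDr expR_ge0.
apply: le_trans; first by apply: ler_sum => s _; exact: bnd.
rewrite -mulr_sumr big_split /=.
have radM (c : R) s : c * rademacher s a = rademacher s (fun j => c * a j).
  by rewrite mulr_sumr; apply: eq_bigr => j _; rewrite mulrCA.
have lbnd (e : R) : e ^+ 2 = D%:R ->
    \sum_s expR (e * rademacher s a) <= 2 ^+ N * expR (2 * D%:R).
  move=> e2; under eq_bigr do rewrite radM.
  apply: le_trans (sum_expR_rademacher_le _) _.
  rewrite ler_pM2l ?exprn_gt0// ler_expR ler_pM2l//.
  under eq_bigr do rewrite exprMn e2.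
  by rewrite -mulr_sumr ler_piMr// ltW.
rewrite (_ : 2 ^+ N * _ =
    (4 * D%:R) ^+ D * (2 ^+ N * expR (2 * D%:R) + 2 ^+ N * expR (2 * D%:R))); last by ring.
rewrite ler_pM2l ?exprn_gt0 ?mulr_gt0//; apply: lerD; first exact: lbnd.
under eq_bigr do rewrite mulrN -mulNr.
by apply: lbnd; rewrite sqrrN.
Qed.
End Khinchine.

(** * The reproducing kernel of a finite-dimensional space of functions *)

(** Used for the measurable functions bounded on the sphere, where integrals are taken, and for
    continuous functions, in the proofs of measurability. *)
Record fun_algebra (R : pzRingType) (T : Type) (L : (T -> R) -> Prop) : Prop :=
  FunAlgebra {
  fa_cst : forall c, L (fun=> c);
  fa_D : forall f g, L f -> L g -> L (fun x => f x + g x);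
  fa_M : forall f g, L f -> L g -> L (fun x => f x * g x) }.

Lemma fa_sum (R : pzRingType) (T : Type) (L : (T -> R) -> Prop) (J : Type) (r : seq J)
    (Q : pred J) (f : J -> T -> R) :
  fun_algebra L -> (forall j, L (f j)) -> L (fun x => \sum_(j <- r | Q j) f j x).
Proof.
move=> LA Lf; elim: r => [|j r IH].
  by under eq_fun do rewrite big_nil; exact: (fa_cst LA 0).
under eq_fun do rewrite big_cons.
by case: (Q j) => //; exact: (fa_D LA).
Qed.

(** The abstract integral. The form I(fg) may be degenerate, so equalities are available only up to
    functions z with I(zz) = 0. *)
Record positive_functional (R : rcfType) (T : Type) (L : (T -> R) -> Prop)
    (I : (T -> R) -> R) : Prop := PositiveFunctional {
  pf_algebra :> fun_algebra L;
  pf_D : forall f g, L f -> L g -> I (fun x => f x + g x) = I f + I g;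
  pf_Z : forall c f, L f -> I (fun x => c * f x) = c * I f;
  pf_ge0 : forall f, L f -> (forall x, 0 <= f x) -> 0 <= I f }.

Section PositiveFunctional.
Variables (R : rcfType) (T : Type) (L : (T -> R) -> Prop) (I : (T -> R) -> R).
Hypothesis LI : positive_functional L I.

Lemma pf_closedZ c f : L f -> L (fun x => c * f x).
Proof. by move=> Lf; apply: (fa_M LI) => //; exact: (fa_cst LI c). Qed.

Lemma pf_sum (J : Type) (r : seq J) (f : J -> T -> R) : (forall j, L (f j)) ->
  I (fun x => \sum_(j <- r) f j x) = \sum_(j <- r) I (f j).
Proof.
move=> Lf; elim: r => [|j r IH].
  under eq_fun do rewrite big_nil.
  by rewrite big_nil; have := pf_Z LI 0 (fa_cst LI 0); rewrite !mul0r.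
under eq_fun do rewrite big_cons.
by rewrite (pf_D LI) ?big_cons ?IH//; exact: (fa_sum _ _ LI).
Qed.

Lemma pf_suml m (c : nat -> R) (f : nat -> T -> R) g :
    (forall i, (i < m)%N -> L (f i)) -> L g ->
  I (fun x => (\sum_(i < m) c i * f i x) * g x) =
  \sum_(i < m) c i * I (fun x => f i x * g x).
Proof.
move=> Lf Lg.
rewrite (_ : (fun _ => _) = fun x => \sum_(i < m) c i * (f i x * g x)); last first.
  by apply/funext => x; rewrite big_distrl; apply: eq_bigr => i _; rewrite mulrA.
rewrite (pf_sum _ (f := fun (i : 'I_m) x => c i * (f i x * g x))); last first.
  by move=> i; apply/pf_closedZ/(fa_M LI) => //; exact: Lf.
apply: eq_bigr => i _; rewrite (pf_Z LI)//; apply: (fa_M LI) => //.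
exact: Lf.
Qed.

(** Cauchy-Schwarz for a degenerate form: integrating (g + t z / 2)^2 gives 0 <= I(gg) + t I(zg) for
    every t, and if I(zg) were nonzero some t would make the right side -1. *)
Lemma pf_null g z : L g -> L z -> I (fun x => z x * z x) = 0 ->
  I (fun x => z x * g x) = 0.
Proof.
move=> Lg Lz z0; set b := I _.
have Lgg := fa_M LI Lg Lg; have Lzg := fa_M LI Lz Lg.
have Lzz := fa_M LI Lz Lz.
have ge0 t : 0 <= I (fun x => g x * g x) + t * b.
  have : 0 <= I (fun x => g x * g x + (t * (z x * g x) + (t ^+ 2 / 4) * (z x * z x))).
    apply: (pf_ge0 LI) => [|x].
      by apply: (fa_D LI) => //; apply: (fa_D LI); exact: pf_closedZ.
    rewrite [leRHS](_ : _ = (g x + t / 2 * z x) ^+ 2) ?sqr_ge0//.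
    by field.
  rewrite (pf_D LI)//; last by apply: (fa_D LI); exact: pf_closedZ.
  rewrite (pf_D LI); [|exact: pf_closedZ..].
  by rewrite !(pf_Z LI)// z0 mulr0 addr0.
apply/eqP; apply: contraT => b0.
have := ge0 (- (I (fun x => g x * g x) + 1) / b).
by rewrite mulfVK//; lra.
Qed.

Lemma gram_schmidt m (h : nat -> T -> R) : (forall i, (i < m)%N -> L (h i)) ->
  exists r (e : nat -> T -> R), [/\ (r <= m)%N, forall i, (i < r)%N -> L (e i),
    forall i j, (i < r)%N -> (j < r)%N -> I (fun x => e i x * e j x) = (i == j)%:R &
    forall i, (i < m)%N -> exists c : nat -> R,
      I (fun x => (h i x - \sum_(k < r) c k * e k x) *
                  (h i x - \sum_(k < r) c k * e k x)) = 0].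
Proof.
elim: m => [_|m IH Lh]; first by exists 0, (fun=> fun=> 0).
have [|r [e [rm Le ee he]]] := IH; first by move=> i im; apply: Lh; exact: ltnW.
have Lhm := Lh m (ltnSn m).
pose c k := I (fun x => h m x * e k x).
pose z x := h m x - \sum_(k < r) c k * e k x.
have Lsum (b : nat -> R) : L (fun x => \sum_(k < r) b k * e k x).
  by apply: (fa_sum _ predT (f := fun (k : 'I_r) x => b k * e k x) LI) => k;
    apply/pf_closedZ/Le.
have LB f g : L f -> L g -> L (fun x => f x - g x).
  move=> Lf Lg; under eq_fun do rewrite -mulN1r.
  by apply: (fa_D LI) => //; exact: pf_closedZ.
have Lz : L z by exact: LB.
have Lzz := fa_M LI Lz Lz.
have ze j : (j < r)%N -> I (fun x => z x * e j x) = 0.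
  move=> jr; have Lej := Le _ jr.
  rewrite (_ : (fun _ => _) = fun x => h m x * e j x +
      (\sum_(k < r) (- c k) * e k x) * e j x); last first.
    apply/funext => x; rewrite /z mulrBl; congr (_ + _).
    by rewrite -mulNr -sumrN; congr (_ * _); apply: eq_bigr => k _; rewrite mulNr.
  rewrite (pf_D LI); [|exact: (fa_M LI Lhm Lej)|]; last first.
    by apply: (fa_M LI) => //; exact: (Lsum (fun k => - c k)).
  rewrite (pf_suml (fun k => - c k) Le Lej) (bigD1 (Ordinal jr)) //= ee// eqxx mulr1.
  rewrite big1 => [|k kj]; first by rewrite addr0 subrr.
  by rewrite ee//; move: kj; rewrite -val_eqE /= => /negbTE ->; rewrite mulr0.
(* A residual of seminorm 0 cannot be normalized: it is dropped and survives as the error of h_m.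
   Otherwise it is scaled to norm 1 and appended. *)
have [z0|zN0] := eqVneq (I (fun x => z x * z x)) 0.
  exists r, e; split=> //; first exact: leqW.
  move=> i; rewrite ltnS leq_eqVlt => /orP[/eqP ->|]; last exact: he.
  by exists c.
set s := I (fun x => z x * z x) in zN0.
have s0 : 0 < s.
  rewrite lt_def zN0 /=; apply: (pf_ge0 LI) => // x.
  by rewrite -expr2 sqr_ge0.
pose a := (Num.sqrt s)^-1.
have aas : a * a * s = 1.
  by rewrite /a -invfM -expr2 sqr_sqrtr ?ltW// mulVf.
have aN0 : a != 0 by rewrite invr_eq0 gt_eqF// sqrtr_gt0.
pose e' k := if k == r then fun x => a * z x else e k.
have e'e k : (k < r)%N -> e' k = e k by move=> kr; rewrite /e' ltn_eqF.
have e'r : e' r = fun x => a * z x by rewrite /e' eqxx.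
have Le' i : (i < r.+1)%N -> L (e' i).
  rewrite ltnS leq_eqVlt => /orP[/eqP ->|ir]; first by rewrite e'r; exact: pf_closedZ.
  by rewrite e'e//; exact: Le.
exists r.+1, e'; split => //.
- have ze' j : (j < r)%N -> I (fun x => a * z x * e j x) = 0.
    move=> jr; rewrite (_ : (fun _ => _) = fun x => a * (z x * e j x)); last first.
      by apply/funext => x; rewrite mulrA.
    rewrite (pf_Z LI) ?ze ?mulr0//; apply: (fa_M LI) => //; exact: Le.
  move=> i j; rewrite ltnS leq_eqVlt => /orP[/eqP ->|ir];
    rewrite ltnS leq_eqVlt => /orP[/eqP ->|jr].
  + rewrite e'r (_ : (fun _ => _) = fun x => a * a * (z x * z x)); last first.
      by apply/funext => x; rewrite mulrACA.
    by rewrite (pf_Z LI)// aas eqxx.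
  + by rewrite e'r e'e// ze'// gtn_eqF.
  + rewrite e'r e'e// ltn_eqF// -[RHS](ze' _ ir); congr I.
    by apply/funext => x; rewrite mulrC.
  + by rewrite !e'e// ee.
- move=> i; rewrite ltnS leq_eqVlt => /orP[/eqP ->|/he[b bP]].
  + exists (fun k => if k == r then a^-1 else c k).
    rewrite (_ : (fun _ => _) = fun=> 0 * 0); last first.
      apply/funext => x; rewrite [X in X * X = _](_ : _ = 0) //.
      rewrite big_ord_recr /= eqxx e'r mulKf// /z.
      rewrite (eq_bigr (fun k : 'I_r => c k * e k x)) => [|k _]; first by ring.
      by rewrite ltn_eqF// e'e.
    by rewrite (pf_Z LI) ?mul0r//; exact: (fa_cst LI 0).
  + exists (fun k => if k == r then 0 else b k).
    rewrite -[RHS]bP; congr I; apply/funext => x.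
    rewrite big_ord_recr /= eqxx mul0r addr0.
    rewrite (eq_bigr (fun k : 'I_r => b k * e k x)) // => k _.
    by rewrite ltn_eqF// e'e.
Qed.

(** By Lagrange's identity. *)
Lemma sum_CauchySchwarz m (b e : nat -> R) :
  (\sum_(k < m) b k * e k) ^+ 2 <= (\sum_(k < m) b k ^+ 2) * (\sum_(k < m) e k ^+ 2).
Proof.
have : 0 <= \sum_(i < m) \sum_(j < m) (b i * e j - b j * e i) ^+ 2.
  by apply: sumr_ge0 => i _; apply: sumr_ge0 => j _; exact: sqr_ge0.
rewrite (_ : \sum_(i < m) _ = 2 * ((\sum_(k < m) b k ^+ 2) * (\sum_(k < m) e k ^+ 2)
   - (\sum_(k < m) b k * e k) ^+ 2)); first by lra.
rewrite mulrBr mulr_natl mulr2n.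
rewrite {1}big_distrlr [X in _ + X - _]mulrC big_distrlr /= expr2 big_distrlr /=.
rewrite mulr_sumr -big_split -sumrB /=; apply: eq_bigr => i _.
rewrite mulr_sumr -big_split -sumrB /=; apply: eq_bigr => j _.
by ring.
Qed.

(* K is the diagonal of the reproducing kernel of the span of the h_i in L^2. *)
Lemma christoffel m (h : nat -> T -> R) : (forall i, (i < m)%N -> L (h i)) ->
  exists K z : T -> R, [/\ L K /\ L z, forall x, 0 <= K x, forall x, 0 <= z x, I z = 0 &
    I K <= m%:R /\ forall (a : nat -> R) x, z x = 0 ->
      (\sum_(i < m) a i * h i x) ^+ 2 <=
      K x * I (fun y => (\sum_(i < m) a i * h i y) ^+ 2)].
Proof.
move=> Lh; have [r [e [rm Le ee he]]] := gram_schmidt Lh.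
have /choice[c cP] : forall i, exists ci : nat -> R, (i < m)%N ->
    I (fun x => (h i x - \sum_(k < r) ci k * e k x) *
                (h i x - \sum_(k < r) ci k * e k x)) = 0.
  move=> i; case: (boolP (i < m)%N) => [/he[ci]|_]; first by exists ci.
  by exists (fun=> 0).
pose z i x := h i x - \sum_(k < r) c i k * e k x.
have Lsum (b : nat -> R) : L (fun x => \sum_(k < r) b k * e k x).
  by apply: (fa_sum _ predT (f := fun (k : 'I_r) x => b k * e k x) LI) => k;
    apply/pf_closedZ/Le.
have Lz i : (i < m)%N -> L (z i).
  move=> im; rewrite /z; under eq_fun do rewrite -mulN1r.
  by apply: (fa_D LI); [exact: Lh|exact: pf_closedZ].
have Lzz (i : 'I_m) : L (fun x => z i x * z i x) by apply: (fa_M LI); exact: Lz.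
have Lee (k : 'I_r) : L (fun x => e k x * e k x) by apply: (fa_M LI); exact: Le.
(* Where the second function vanishes, every h_i equals its projection exactly, so one null set
   serves all coefficient vectors [a]. *)
exists (fun x => \sum_(k < r) e k x * e k x), (fun x => \sum_(i < m) z i x * z i x).
have sq (y : R) : 0 <= y * y by rewrite -expr2 sqr_ge0.
split.
- by split; [exact: (fa_sum _ predT LI Lee)|exact: (fa_sum _ predT LI Lzz)].
- by move=> x; apply: sumr_ge0.
- by move=> x; apply: sumr_ge0.
- by rewrite (pf_sum _ Lzz) big1// => i _; exact: cP.
split.
  rewrite (pf_sum _ Lee) (eq_bigr (fun=> 1)) => [|k _]; last by rewrite ee ?eqxx.
  by rewrite sumr_const card_ord ler_nat.
move=> a x zx.
pose b k := \sum_(i < m) a i * c i k.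
pose g y := \sum_(k < r) b k * e k y.
pose w y := \sum_(i < m) a i * z i y.
have fE y : \sum_(i < m) a i * h i y = g y + w y.
  rewrite /g /w /b (eq_bigr (fun i : 'I_m => a i * z i y + \sum_(k < r) a i * c i k * e k y)).
    rewrite big_split /= addrC; congr (_ + _); rewrite exchange_big /=.
    by apply: eq_bigr => k _; rewrite big_distrl.
  move=> i _; rewrite /z mulrBr big_distrr /=.
  by under [X in _ - X + _]eq_bigr do rewrite mulrA; rewrite subrK.
have wx : w x = 0.
  apply: big1 => i _.
  have : z i x * z i x = 0.
    apply/eqP; move: zx => /eqP; rewrite psumr_eq0// => /allP/(_ i).
    by rewrite mem_index_enum => /(_ isT).
  by move/eqP; rewrite mulf_eq0 orbb => /eqP ->; rewrite mulr0.
have Lg : L g by exact: Lsum.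
have Lw : L w by apply: (fa_sum _ predT (f := fun (i : 'I_m) x => a i * z i x) LI) => i;
  apply/pf_closedZ/Lz.
have Iwg : I (fun y => w y * g y) = 0.
  rewrite (pf_suml a Lz Lg) big1// => i _.
  by rewrite pf_null ?mulr0//; [exact: Lz|exact: cP].
have Igg : I (fun y => g y * g y) = \sum_(k < r) b k ^+ 2.
  rewrite {1}/g (pf_suml b Le Lg); apply: eq_bigr => k _; rewrite expr2; congr (_ * _).
  rewrite (_ : (fun _ => _) = (fun y => g y * e k y)); last first.
    by apply/funext => y; rewrite mulrC.
  rewrite (pf_suml b Le (Le _ _))// (bigD1 k) //= ee// eqxx mulr1 big1 ?addr0// => j jk.
  by rewrite ee//; move: jk; rewrite -val_eqE /= => /negbTE ->; rewrite mulr0.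
(* The combination is g + w with g in the span of the e_k and w null against it, so its second
   moment is at least I(gg), the sum of the b_k^2. At x it reduces to g(x), to which Cauchy-Schwarz
   applies. *)
have If : \sum_(k < r) b k ^+ 2 <= I (fun y => (\sum_(i < m) a i * h i y) ^+ 2).
  rewrite (_ : (fun _ => _) = fun y => g y * g y + (2 * (w y * g y) + w y * w y)).
    have Lwg := fa_M LI Lw Lg; have Lww := fa_M LI Lw Lw.
    rewrite (pf_D LI); [|exact: (fa_M LI Lg Lg)|]; last first.
      by apply: (fa_D LI) => //; exact: pf_closedZ.
    rewrite (pf_D LI)//; last exact: pf_closedZ.
    by rewrite (pf_Z LI)// Iwg mulr0 add0r Igg lerDl; apply: (pf_ge0 LI).
  by apply/funext => y; rewrite fE; ring.
rewrite fE wx addr0 (le_trans (sum_CauchySchwarz r b (fun k => e k x)))//.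
rewrite mulrC; under eq_bigr do rewrite expr2.
by apply: ler_wpM2l => //; apply: sumr_ge0.
Qed.

Lemma christoffel_fin (J : finType) (h : J -> T -> R) : (forall j, L (h j)) ->
  exists K z : T -> R, [/\ L K /\ L z, forall x, 0 <= K x, forall x, 0 <= z x, I z = 0 &
    I K <= #|J|%:R /\ forall (a : J -> R) x, z x = 0 ->
      (\sum_j a j * h j x) ^+ 2 <= K x * I (fun y => (\sum_j a j * h j y) ^+ 2)].
Proof.
move=> Lh; pose ext (U : Type) (u : U) (f : J -> U) (i : nat) :=
  if insub i is Some k then f (enum_val (k : 'I_#|J|)) else u.
have Lh' i : (i < #|J|)%N -> L (ext _ (fun=> 0) h i).
  by move=> im; rewrite /ext; case: insubP => // _; exact: (fa_cst LI 0).
have sumE (a : J -> R) x : \sum_j a j * h j x =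
    \sum_(i < #|J|) ext _ 0 a i * ext _ (fun=> 0) h i x.
  rewrite (reindex (@enum_val J J)) /=; last first.
    by apply: onW_bij; exact: enum_val_bij.
  by apply: eq_bigr => i _; rewrite /ext !valK.
have [K [z [LKz K0 z0 Iz [IK Kh]]]] := christoffel Lh'.
exists K, z; split=> //; split=> // a x zx.
rewrite sumE [X in I X](_ : _ = fun y => (\sum_(i < #|J|)
    ext _ 0 a i * ext _ (fun=> 0) h i y) ^+ 2); first exact: (Kh (ext _ 0 a) x zx).
by apply/funext => y; rewrite sumE.
Qed.

End PositiveFunctional.

(** * Complex numbers and inner products *)

Notation Rec := complex.Re.
Notation Imc := complex.Im.

Section ComplexNumbers.
Variable R : rcfType.
Implicit Types z w : R[i].

Lemma conjCE z : z^* = conjc z.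
Proof.
have [->|z0] := eqVneq z 0; first by rewrite !rmorph0.
by apply: (mulfI z0); rewrite -normCK sqr_normc.
Qed.

Lemma complex_ReD z w : Rec (z + w) = Rec z + Rec w.
Proof. by case: z w => [a b] [c d]. Qed.

Lemma complex_ImD z w : Imc (z + w) = Imc z + Imc w.
Proof. by case: z w => [a b] [c d]. Qed.

(** The sign is written as a factor -1 so that the closure properties of [fun_algebra] apply
    directly. *)
Lemma complex_ReM z w : Rec (z * w) = Rec z * Rec w + - 1 * (Imc z * Imc w).
Proof. by case: z w => [a b] [c d]; rewrite mulN1r. Qed.

Lemma complex_ImM z w : Imc (z * w) = Rec z * Imc w + Imc z * Rec w.
Proof. by case: z w => [a b] [c d]. Qed.

Lemma complex_Re_conj z : Rec z^* = Rec z.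
Proof. by rewrite conjCE; case: z. Qed.

Lemma complex_Im_conj z : Imc z^* = - 1 * Imc z.
Proof. by rewrite conjCE mulN1r; case: z. Qed.

Lemma complex_Re_realM z (c : R) : Rec (z * ((c%:C)%C)^*) = Rec z * c.
Proof. by rewrite conjCE; case: z => a b /=; rewrite oppr0 mulr0 subr0. Qed.

Lemma complex_Im_realM z (c : R) : Imc (z * ((c%:C)%C)^*) = Imc z * c.
Proof. by rewrite conjCE; case: z => a b /=; rewrite oppr0 mulr0 add0r. Qed.

(** The squared modulus as an element of R, whereas [|z| ^+ 2] lives in R[i]. *)
Definition sqnorm z : R := Rec z * Rec z + Imc z * Imc z.

Lemma sqnormE z : ((sqnorm z)%:C)%C = `|z| ^+ 2.
Proof. by rewrite -add_Re2_Im2 /sqnorm -!expr2. Qed.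

Lemma sqnorm_ge0 z : 0 <= sqnorm z.
Proof. by rewrite /sqnorm -!expr2 addr_ge0 ?sqr_ge0. Qed.

Lemma sqnormM z w : sqnorm (z * w) = sqnorm z * sqnorm w.
Proof. by rewrite /sqnorm complex_ReM complex_ImM; ring. Qed.

Lemma sqnormX z k : sqnorm (z ^+ k) = sqnorm z ^+ k.
Proof.
elim: k => [|k IH]; last by rewrite !exprS sqnormM IH.
by rewrite !expr0 /sqnorm /= mulr1 mulr0 addr0.
Qed.

Lemma sqnorm_real (x : R) : sqnorm (x%:C)%C = x ^+ 2.
Proof. by rewrite /sqnorm /= mulr0 addr0 -expr2. Qed.

End ComplexNumbers.

Section Complexified.
Variables (R : rcfType) (T : Type) (L : (T -> R) -> Prop).
Hypothesis LA : fun_algebra L.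

Definition complexified (F : T -> R[i]) :=
  L (fun x => Rec (F x)) /\ L (fun x => Imc (F x)).

Lemma cx_cst c : complexified (fun=> c).
Proof. by split; exact: (fa_cst LA). Qed.

Lemma cx_D F G : complexified F -> complexified G ->
  complexified (fun x => F x + G x).
Proof.
move=> [F1 F2] [G1 G2]; split.
- by under eq_fun do rewrite complex_ReD; exact: (fa_D LA).
- by under eq_fun do rewrite complex_ImD; exact: (fa_D LA).
Qed.

Lemma cx_M F G : complexified F -> complexified G ->
  complexified (fun x => F x * G x).
Proof.
move=> [F1 F2] [G1 G2]; split.
- under eq_fun do rewrite complex_ReM.
  apply: (fa_D LA); first exact: (fa_M LA).
  by apply: (fa_M LA); [exact: (fa_cst LA)|exact: (fa_M LA)].
- under eq_fun do rewrite complex_ImM.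
  by apply: (fa_D LA); exact: (fa_M LA).
Qed.

Lemma cx_conj F : complexified F -> complexified (fun x => (F x)^*).
Proof.
move=> [F1 F2]; split.
- by under eq_fun do rewrite complex_Re_conj.
- under eq_fun do rewrite complex_Im_conj.
  by apply: (fa_M LA) => //; exact: (fa_cst LA).
Qed.

Lemma cx_sum (J : Type) (r : seq J) (Q : pred J) (F : J -> T -> R[i]) :
  (forall j, complexified (F j)) -> complexified (fun x => \sum_(j <- r | Q j) F j x).
Proof.
move=> cF; elim: r => [|j r IH].
  by under eq_fun do rewrite big_nil; exact: cx_cst.
under eq_fun do rewrite big_cons.
by case: (Q j) => //; exact: cx_D.
Qed.

Lemma cx_prod (J : Type) (r : seq J) (Q : pred J) (F : J -> T -> R[i]) :
  (forall j, complexified (F j)) -> complexified (fun x => \prod_(j <- r | Q j) F j x).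
Proof.
move=> cF; elim: r => [|j r IH].
  by under eq_fun do rewrite big_nil; exact: cx_cst.
under eq_fun do rewrite big_cons.
by case: (Q j) => //; exact: cx_M.
Qed.

Lemma fa_exp f k : L f -> L (fun x => f x ^+ k).
Proof.
move=> Lf; elim: k => [|k IH].
  by under eq_fun do rewrite expr0; exact: (fa_cst LA).
by under eq_fun do rewrite exprS; exact: (fa_M LA).
Qed.

Lemma cx_sqnorm F : complexified F -> L (fun x => sqnorm (F x)).
Proof. by move=> [F1 F2]; apply: (fa_D LA); exact: (fa_M LA). Qed.

End Complexified.

Section Dotmx.
Variables (C : numClosedFieldType) (N : nat).
Implicit Types u v : 'rV[C]_N.

Lemma dotmx_sum u v : dotmx u v = \sum_j u 0 j * (v 0 j)^*.
Proof. by rewrite dotmxE mxE; apply: eq_bigr => j _; rewrite !mxE. Qed.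

Lemma dotmxZl (a : C) u v : dotmx (a *: u) v = a * dotmx u v.
Proof.
by rewrite !dotmx_sum mulr_sumr; apply: eq_bigr => j _; rewrite mxE mulrA.
Qed.

Lemma dotmxZr (a : C) u v : dotmx u (a *: v) = a^* * dotmx u v.
Proof.
rewrite !dotmx_sum mulr_sumr; apply: eq_bigr => j _.
by rewrite mxE rmorphM mulrCA.
Qed.

Lemma dotmx_mulmx u v (U : 'M[C]_N) :
  dotmx (u *m U) v = dotmx u (v *m map_mx Num.conj U^T).
Proof.
rewrite !dotmxE -mulmxA; congr (fun_of_matrix (u *m _) 0 0).
by rewrite trmx_mul map_mxM trmxCK.
Qed.

End Dotmx.

Lemma dotmx_sqnorm (R : rcfType) N (u : 'rV[R[i]]_N) : dotmx u u = ((\sum_j sqnorm (u 0 j))%:C)%C.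
Proof.
rewrite dotmx_sum rmorph_sum; apply: eq_bigr => j _.
by rewrite /= sqnormE normCK.
Qed.

(* Two unit rows are the first rows of unitary matrices V and V', and V^* V' maps
   the one to the other. *)
Lemma unitary_transitive (C : numClosedFieldType) (N : nat) (u v : 'rV[C]_N) :
  dotmx u u = 1 -> dotmx v v = 1 -> exists2 U, U \is unitarymx & v = u *m U.
Proof.
case: N u v => [|N] u v u1 v1.
  exists 1%:M; last by apply/rowP => -[].
  by apply/unitarymxP; rewrite mul1mx trmx1 map_mx1.
have first_row (w : 'rV[C]_N.+1) : dotmx w w = 1 ->
    exists2 V : 'M[C]_N.+1, V \is unitarymx & w = row ord0 V.
  (* [schmidt] completes the zero rows to a unitary matrix. Then w = a r for its first row r, with a
     >= 0; both being unit vectors, a = 1. *)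
  move=> w1; pose A : 'M[C]_N.+1 := \matrix_i (if i == ord0 then w else 0).
  have Aw : row ord0 A = w by rewrite rowK eqxx.
  have VU : schmidt A \is unitarymx by exact: schmidt_unitarymx.
  exists (schmidt A) => //.
  have := row_schmidt_sub A ord0.
  rewrite Aw (big_pred1 ord0) => [|i]; last by rewrite leqn0.
  rewrite genmxE => /sub_rVP[a wa].
  have ss : dotmx (row ord0 (schmidt A)) (row ord0 (schmidt A)) = 1.
    by have /row_unitarymxP := VU => /(_ ord0 ord0); rewrite eqxx.
  have := form1_row_schmidt A ord0; rewrite Aw.
  move: w1; rewrite wa; set r := row _ _ in ss *.
  rewrite !dotmxZl dotmxZr ss !mulr1 => aa1 a0.
  have : a ^+ 2 = 1 by rewrite expr2 -{2}(geC0_conj a0).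
  by move/eqP; rewrite sqrp_eq1// => /eqP ->; rewrite scale1r.
have [V VU uV] := first_row u u1; have [V' VU' vV'] := first_row v v1.
exists (map_mx Num.conj V^T *m V'); first by rewrite mul_unitarymx ?trmxC_unitary.
rewrite {1}uV vV' mulmxA -row_mul; have /unitarymxP -> := VU.
by rewrite row1 -rowE.
Qed.

(** * Overlaps with a Haar random state *)

Lemma Re_continuous (R : realType) : continuous (fun z : R[i]^o => Rec z).
Proof.
move=> z; apply/(@cvgrPdist_lt R R^o (R[i]^o) (nbhs (z : R[i]^o)) _ (@complex.Re R)) => e e0.
have zb : nbhs (z : R[i]^o) (ball (z : R[i]^o) (e%:C)%C).
  by apply: nbhsx_ballx; rewrite ltcR.
apply: (@filterS _ (nbhs (z : R[i]^o)) _ _ _ _ zb) => w; rewrite -ball_normE /=.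
rewrite -ltcR; apply: le_lt_trans.
rewrite (_ : complex.Re z - complex.Re w = complex.Re (z - w)).
  exact: normc_ge_Re.
by case: z {zb} w => [a b] [c d].
Qed.

Lemma Im_continuous (R : realType) : continuous (fun z : R[i]^o => Imc z).
Proof.
have -> : (fun z : R[i]^o => Imc z) = (fun z : R[i]^o => Rec (- 'i * z)).
  by apply/funext => -[a b] /=; rewrite mulN1r opprK oppr0 mul0r add0r.
move=> z; apply: continuous_comp; last exact: Re_continuous.
exact: (@mulrl_continuous R[i] (- 'i) z).
Qed.

Lemma fun_algebra_continuous (R : realType) (X : topologicalType) :
  fun_algebra (fun f : X -> R => continuous f).
Proof.
split=> [c|f g cf cg|f g cf cg] x; first exact: cvg_cst.
- by apply: cvgD; [exact: cf|exact: cg].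
- by apply: cvgM; [exact: cf|exact: cg].
Qed.

Lemma complexified_coord (R : realType) (N : nat) (j : 'I_N) :
  complexified (fun f : 'rV[R[i]^o]_N -> R => continuous f) (fun u => u 0 j).
Proof.
by split=> u; (apply: continuous_comp; first exact: coord_continuous);
  [exact: Re_continuous|exact: Im_continuous].
Qed.

Lemma continuous_measurable_qstate (R : realType) (n : nat)
    (f : 'rV[R[i]^o]_#|bits n| -> R) :
  continuous f -> measurable_fun [set: qstate_borel R n] f.
Proof.
move=> cf; apply: (measurability _ (RGenOInfty.measurableE R)) => //= _ [_ [x ->] <-].
rewrite setTI; apply: sub_sigma_algebra.
by apply: open_comp; [move=> + _; exact: cf|exact: interval_open].
Qed.

Section Haar.
Variables (R : realType) (n : nat) (P : probability (qstate_borel R n) R).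
Hypothesis haarP : haar_measure P.
Let N := #|bits n|.

Definition sphere : set (qstate_borel R n) := [set psi | dotmx psi psi = 1].

(** Boundedness is required on the sphere only, since coordinates are unbounded on the ambient
    space. *)
Definition sphere_bounded (f : qstate_borel R n -> R) :=
  measurable_fun setT f /\ exists b, forall psi, sphere psi -> `|f psi| <= b.

Definition sphere_integral (f : qstate_borel R n -> R) : R :=
  (\int[P]_(psi in sphere) f psi)%R.

Lemma sphereP (psi : qstate_borel R n) :
  sphere psi <-> \sum_j sqnorm (psi 0 j) = 1.
Proof.
rewrite /sphere /= dotmx_sqnorm; split=> [|->]; last by [].
by move/complexI.
Qed.

Lemma continuous_sqnorm_coord (j : 'I_N) :
  continuous (fun psi : 'rV[R[i]^o]_N => sqnorm (psi 0 j) : R).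
Proof.
exact: (@cx_sqnorm R _ _ (@fun_algebra_continuous R 'rV[R[i]^o]_N) _ (complexified_coord R j)).
Qed.

Lemma measurable_sphere : measurable sphere.
Proof.
have -> : sphere = setT `&` (fun psi => \sum_j sqnorm (psi 0 j)) @^-1` [set 1].
  by rewrite setTI; apply/seteqP; split => psi /=; [move/sphereP|move=> ?; apply/sphereP].
suff : measurable_fun [set: qstate_borel R n] (fun psi => \sum_j sqnorm (psi 0 j)).
  by move=> mf; exact: (mf measurableT _ (measurable_set1 1)).
apply: measurable_sum => j; apply: continuous_measurable_qstate.
exact: continuous_sqnorm_coord.
Qed.

Lemma sqnorm_coord_le1 psi j : sphere psi -> sqnorm (psi 0 j) <= 1.
Proof.
move=> /sphereP <-; rewrite (bigD1 j) //= lerDl sumr_ge0// => i _.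
exact: sqnorm_ge0.
Qed.

Lemma fun_algebra_sphere_bounded : fun_algebra sphere_bounded.
Proof.
split=> [c|f g [mf [a fa]] [mg [b gb]]|f g [mf [a fa]] [mg [b gb]]].
- by split; [exact: measurable_cst|exists `|c|].
- split; first exact: measurable_funD.
  by exists (a + b) => psi S; rewrite (le_trans (ler_normD _ _))// lerD ?fa ?gb.
- split; first exact: measurable_funM.
  by exists (a * b) => psi S; rewrite normrM ler_pM ?fa ?gb.
Qed.

Lemma sphere_bounded_integrable f : sphere_bounded f ->
  P.-integrable sphere (EFin \o f).
Proof.
move=> [mf [b fb]]; apply: measurable_bounded_integrable.
- exact: measurable_sphere.
- by rewrite (le_lt_trans (probability_le1 _ measurable_sphere)) ?ltry.
- exact: measurable_funTS.
- exists b; split; first exact: num_real.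
  by move=> y by_ psi /fb /le_trans; apply; exact: ltW.
Qed.

Lemma complexified_sphere_bounded_coord j :
  complexified sphere_bounded (fun psi => psi 0 j).
Proof.
have [cR cI] := @complexified_coord R N j.
split; (split; first exact: continuous_measurable_qstate); exists 1 => psi /sqnorm_coord_le1;
  move=> /(_ j) h; have : 0 <= Rec (psi 0 j) * Rec (psi 0 j) by rewrite -expr2 sqr_ge0.
- have : 0 <= Imc (psi 0 j) * Imc (psi 0 j) by rewrite -expr2 sqr_ge0.
  move: h; rewrite /sqnorm => h h1 h2; rewrite -(@ler_pXn2r _ 2)// ?nnegrE//.
  by rewrite real_normK ?num_real// expr1n expr2; lra.
- have : 0 <= Imc (psi 0 j) * Imc (psi 0 j) by rewrite -expr2 sqr_ge0.
  move: h; rewrite /sqnorm => h h1 h2; rewrite -(@ler_pXn2r _ 2)// ?nnegrE//.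
  by rewrite real_normK ?num_real// expr1n expr2; lra.
Qed.

Lemma sphere_functional : positive_functional sphere_bounded sphere_integral.
Proof.
have mS := measurable_sphere.
split; first exact: fun_algebra_sphere_bounded.
- by move=> f g Lf Lg; apply: RintegralD => //; exact: sphere_bounded_integrable.
- by move=> c f Lf; apply: RintegralZl => //; exact: sphere_bounded_integrable.
- by move=> f _ f0; apply: Rintegral_ge0.
Qed.

Lemma sphere_integral_le f b : sphere_bounded f -> (forall psi, sphere psi -> f psi <= b) ->
  sphere_integral f <= b.
Proof.
move=> Lf fb; have mS := measurable_sphere.
have PS : P sphere = 1%E by case: haarP.
apply: (@le_trans _ _ (sphere_integral (fun=> b))).
  apply: le_Rintegral => //; apply: sphere_bounded_integrable => //.
  exact: (fa_cst fun_algebra_sphere_bounded).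
have PS1 : fine (P sphere) = 1 by rewrite PS.
by rewrite /sphere_integral Rintegral_cst// -[leRHS]mulr1 -PS1.
Qed.

(** Invariance of the Haar measure speaks of sets, so it reaches integrals through the law of f on
    the real line. The integrand there is |y|, to stay nonnegative on all of R. *)
Lemma eq_law_integral (f g : qstate_borel R n -> R) :
  measurable_fun setT f -> measurable_fun setT g ->
  (forall psi, 0 <= f psi) -> (forall psi, 0 <= g psi) ->
  (forall B, measurable B -> P (f @^-1` B) = P (g @^-1` B)) ->
  (\int[P]_psi (f psi)%:E = \int[P]_psi (g psi)%:E)%E.
Proof.
move=> mf mg f0 g0 fg.
pose fm := isMeasurableFun.Build _ _ _ _ _ mf.
pose gm := isMeasurableFun.Build _ _ _ _ _ mg.
pose X : {RV P >-> R} := HB.pack f fm.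
pose Y : {RV P >-> R} := HB.pack g gm.
have absE (Z : {RV P >-> R}) : (forall psi, 0 <= Z psi) ->
    (\int[P]_psi (Z psi)%:E = \int[distribution P Z]_y `|y|%:E)%E.
  move=> Z0; rewrite ge0_integral_distribution//=.
    by apply: eq_integral => psi _ /=; rewrite ger0_norm.
  by apply/measurable_EFinP; exact: normr_measurable.
rewrite -[LHS]/(\int[P]_psi (X psi)%:E)%E -[RHS]/(\int[P]_psi (Y psi)%:E)%E.
rewrite !absE//; apply: eq_measure_integral => B mB _.
exact: fg.
Qed.

Lemma sphere_integralE (f : qstate_borel R n -> R) :
  measurable_fun setT f -> (forall psi, 0 <= f psi) ->
  sphere_integral f = fine (\int[P]_psi (f psi)%:E)%E.
Proof.
move=> mf f0; rewrite /sphere_integral /Rintegral; congr fine.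
have mS := measurable_sphere.
rewrite [RHS](@ge0_negligible_integral _ _ _ P setT (~` sphere))//=.
- by rewrite setTD setCK.
- exact: measurableC.
- exact/measurable_EFinP.
- by move=> psi _; rewrite lee_fin.
- have -> : (P (~` sphere) = 1 - P sphere)%E by rewrite probability_setC.
  by case: haarP => + _; rewrite -/sphere => ->; rewrite subee.
Qed.

(** * Moments of the overlap with a fixed unit vector *)

Definition overlap_moment D phi :=
  sphere_integral (fun psi => sqnorm (dotmx psi phi) ^+ D).

Lemma complexified_overlap phi : complexified sphere_bounded
  (fun psi => dotmx psi phi).
Proof.
under eq_fun do rewrite dotmx_sum.
apply: (cx_sum fun_algebra_sphere_bounded) => j.
apply: (cx_M fun_algebra_sphere_bounded).
  exact: complexified_sphere_bounded_coord.
exact: (cx_cst fun_algebra_sphere_bounded).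
Qed.

Lemma overlap_moment_bounded D phi :
  sphere_bounded (fun psi => sqnorm (dotmx psi phi) ^+ D).
Proof.
apply: (fa_exp fun_algebra_sphere_bounded).
exact: (cx_sqnorm fun_algebra_sphere_bounded (complexified_overlap _)).
Qed.

(** If phi' = phi U, then the overlap of psi with phi' is that of psi U^* with phi, and psi U^* has
    the law of psi. *)
Lemma overlap_moment_unit D phi phi' : dotmx phi phi = 1 -> dotmx phi' phi' = 1 ->
  overlap_moment D phi = overlap_moment D phi'.
Proof.
move=> phi1 phi1'; have [U UU ->] := unitary_transitive phi1 phi1'.
have [m1 _] := overlap_moment_bounded D phi.
have [m2 _] := overlap_moment_bounded D (phi *m U).
have ge0 ph (psi : qstate_borel R n) : 0 <= sqnorm (dotmx psi ph) ^+ D.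
  by rewrite exprn_ge0// sqnorm_ge0.
apply: (etrans (sphere_integralE m1 (ge0 _))).
apply: (etrans _ (esym (sphere_integralE m2 (ge0 _)))).
apply: congr1; apply: (eq_law_integral m1 m2 (ge0 _) (ge0 _)) => B mB.
have mB' : measurable ((fun psi : qstate_borel R n => sqnorm (dotmx psi phi) ^+ D) @^-1` B).
  by rewrite -[X in measurable X]setTI; exact: m1.
have VU : map_mx Num.conj U^T \is unitarymx by rewrite trmxC_unitary.
have [_ invP] := haarP.
apply: (etrans (esym (invP _ VU _ mB'))); apply: congr1.
apply/funext => psi; rewrite /preimage /=; apply: congr1.
by rewrite dotmx_mulmx trmxCK.
Qed.

Definition sign_state (s : {ffun 'I_N -> bool}) : 'rV[R[i]]_N :=
  \row_j (((-1) ^+ s j / Num.sqrt N%:R)%:C)%C.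

Lemma N_gt0 : (0 < N)%N.
Proof. by rewrite /N card_ffun card_bool expn_gt0. Qed.

Lemma sqrtN2 : Num.sqrt (N%:R : R) ^+ 2 = N%:R.
Proof. by rewrite sqr_sqrtr. Qed.

Lemma sign_state_unit s : dotmx (sign_state s) (sign_state s) = 1.
Proof.
rewrite dotmx_sqnorm (eq_bigr (fun=> N%:R^-1)) => [|j _]; last first.
  by rewrite mxE sqnorm_real expr_div_n sqrtN2 sqrr_sign div1r.
rewrite sumr_const card_ord -[X in (X%:C)%C]mulr_natr mulVf//.
by rewrite pnatr_eq0 -lt0n N_gt0.
Qed.

Lemma sqnorm_overlap_sign psi s : sqnorm (dotmx psi (sign_state s)) =
  (rademacher s (fun j => Rec (psi 0 j)) ^+ 2 +
   rademacher s (fun j => Imc (psi 0 j)) ^+ 2) / N%:R.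
Proof.
have sumM (x : 'I_N -> R) : \sum_j x j * ((-1) ^+ s j / Num.sqrt N%:R) =
    rademacher s x / Num.sqrt N%:R.
  by rewrite /rademacher mulr_suml; apply: eq_bigr => j _; rewrite mulrCA mulrA.
have ReE : Rec (dotmx psi (sign_state s)) =
    rademacher s (fun j => Rec (psi 0 j)) / Num.sqrt N%:R.
  rewrite dotmx_sum (big_morph _ (@complex_ReD R) (erefl : Rec 0 = 0)) -sumM.
  by apply: eq_bigr => j _; rewrite mxE complex_Re_realM.
have ImE : Imc (dotmx psi (sign_state s)) =
    rademacher s (fun j => Imc (psi 0 j)) / Num.sqrt N%:R.
  rewrite dotmx_sum (big_morph _ (@complex_ImD R) (erefl : Imc 0 = 0)) -sumM.
  by apply: eq_bigr => j _; rewrite mxE complex_Im_realM.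
by rewrite /sqnorm ReE ImE -!expr2 !expr_div_n sqrtN2 mulrDl.
Qed.

(** The moment is the average over sign vectors. Real signs split the overlap into Rademacher sums
    of the real and of the imaginary parts of psi: separating them costs 2^D, which with the 4^D of
    [khinchine] gives 8^D, and the two sums with its factor 2 give the leading 4. *)
Lemma overlap_moment_le D phi : (0 < D)%N -> dotmx phi phi = 1 ->
  overlap_moment D phi <= 4 * (8 * expR 2 * D%:R / N%:R) ^+ D.
Proof.
move=> D0 phi1.
have Np : 0 < N%:R :> R by rewrite ltr0n N_gt0.
have : sphere_integral (fun psi => \sum_s sqnorm (dotmx psi (sign_state s)) ^+ D) =
    2 ^+ N * overlap_moment D phi.
  rewrite (pf_sum sphere_functional); last by move=> s; exact: overlap_moment_bounded.
  rewrite (eq_bigr (fun=> overlap_moment D phi)) => [|s _]; last first.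
    exact: (overlap_moment_unit D (sign_state_unit s) phi1).
  by rewrite sumr_const card_ffun card_bool card_ord -natrX mulr_natl.
move=> H; rewrite -(@ler_pM2l _ (2 ^+ N)) ?exprn_gt0// -{}H.
apply: sphere_integral_le.
  apply: (fa_sum _ _ sphere_functional) => s; exact: overlap_moment_bounded.
move=> psi /sphereP psi1.
have two_pow (a b : R) : 0 <= a -> 0 <= b -> (a + b) ^+ D <= 2 ^+ D * (a ^+ D + b ^+ D).
  wlog ab : a b / a <= b => [wl a0 b0|a0 b0].
    case: (leP a b) => [/wl|/ltW/wl]; first exact.
    by rewrite addrC [a ^+ D + _]addrC; exact.
  apply: (@le_trans _ _ ((2 * b) ^+ D)).
    by apply: lerXn2r; rewrite ?nnegrE ?addr_ge0 ?mulr_ge0//; lra.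
  by rewrite exprMn ler_pM2l ?exprn_gt0// lerDr exprn_ge0.
have K (a : 'I_N -> R) : (forall j, a j ^+ 2 <= sqnorm (psi 0 j)) ->
    \sum_s (rademacher s a ^+ 2) ^+ D <=
    2 ^+ N * (2 * ((4 * D%:R) ^+ D * expR (2 * D%:R))).
  by move=> ha; apply: khinchine => //; rewrite -psi1; apply: ler_sum.
have K1 := K (fun j => Rec (psi 0 j)) _.
have K2 := K (fun j => Imc (psi 0 j)) _.
apply: (@le_trans _ _ (\sum_s 2 ^+ D / N%:R ^+ D *
   ((rademacher s (fun j => Rec (psi 0 j)) ^+ 2) ^+ D +
    (rademacher s (fun j => Imc (psi 0 j)) ^+ 2) ^+ D))).
  apply: ler_sum => s _; rewrite sqnorm_overlap_sign expr_div_n.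
  rewrite [leRHS]mulrAC ler_pM2r ?invr_gt0 ?exprn_gt0//.
  by apply: two_pow; exact: sqr_ge0.
rewrite -mulr_sumr big_split /=.
have {K1 K2} KK := lerD (K1 _) (K2 _).
apply: (@le_trans _ _ (2 ^+ D / N%:R ^+ D *
  (2 ^+ N * (2 * ((4 * D%:R) ^+ D * expR (2 * D%:R))) +
   2 ^+ N * (2 * ((4 * D%:R) ^+ D * expR (2 * D%:R)))))).
  rewrite ler_pM2l ?divr_gt0 ?exprn_gt0//; apply: KK => j.
    by rewrite /sqnorm expr2 lerDl -expr2 sqr_ge0.
  by rewrite /sqnorm expr2 lerDr -expr2 sqr_ge0.
rewrite expRM_natr expr_div_n !exprMn.
have -> : (8 : R) ^+ D = 2 ^+ D * 4 ^+ D by rewrite -exprMn; congr (_ ^+ _); ring.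
move: (2 ^+ N) (2 ^+ D) (4 ^+ D) (D%:R ^+ D) (expR 2 ^+ D) (N%:R ^+ D)^-1 => x1 x2 x3 x4 x5 x6.
by rewrite le_eqVlt; apply/orP; left; apply/eqP; ring.
Qed.

(** * The kernel bound for a family of small rank *)

Definition bits_state (f : bits n -> R[i]) : 'rV[R[i]]_N := \row_j f (enum_val j).

(** The D-th power of the overlap expands over words g of length D; the dependence on f is the
    conjugate of its D-th tensor power at g, which [rank_le] expands. *)
Lemma overlap_exp_span (D M : nat) (F : (bits n -> R[i]) -> Prop) : rank_le D M F ->
  exists (I : finType) (H : I -> qstate_borel R n -> R[i]), [/\ (#|I| <= M)%N,
    forall i, complexified sphere_bounded (H i) &
    forall f, F f -> exists c : I -> R[i], forall psi,
      dotmx psi (bits_state f) ^+ D = \sum_i c i * H i psi].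
Proof.
move=> [I [w [IM wP]]].
pose xs (g : {ffun 'I_D -> 'I_N}) : seq (bits n) :=
  [seq enum_val (g k) | k <- index_enum 'I_D].
exists I, (fun i (psi : qstate_borel R n) => \sum_(g : {ffun 'I_D -> 'I_N})
  (\prod_k psi 0 (g k)) * (w i (xs g))^*).
have LA := fun_algebra_sphere_bounded.
split=> //.
  move=> i; apply: (cx_sum LA) => g; apply: (cx_M LA); last exact: (cx_cst LA).
  by apply: (cx_prod LA) => k; exact: complexified_sphere_bounded_coord.
move=> f /wP[c cP]; exists (fun i => (c D i)^*) => psi.
rewrite dotmx_sum -[X in _ ^+ X](card_ord D) -prodr_const bigA_distr_bigA /=.
under [RHS]eq_bigr do rewrite mulr_sumr.
rewrite exchange_big /=; apply: eq_bigr => g _.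
rewrite big_split /=.
have sxs : size (xs g) = D.
  by rewrite size_map -[RHS](card_ord D) cardE enumT.
have -> : \prod_(k < D) (bits_state f 0 (g k))^* = (\prod_(x <- xs g) f x)^*.
  by rewrite big_map rmorph_prod; apply: eq_bigr => k _; rewrite mxE.
rewrite cP ?sxs// rmorph_sum mulr_sumr; apply: eq_bigr => i _.
by rewrite rmorphM /= mulrCA.
Qed.

(** The real and imaginary parts of the D-th power are real combinations of the 2M functions Re H_i
    and Im H_i. The kernel inequality for each, added up, gives the moment of the modulus. *)
Lemma overlap_kernel (D M : nat) (F : (bits n -> R[i]) -> Prop) : rank_le D M F ->
  exists K z : qstate_borel R n -> R, [/\ sphere_bounded K /\ sphere_bounded z,
    forall psi, 0 <= K psi, forall psi, 0 <= z psi, sphere_integral z = 0 &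
    sphere_integral K <= (2 * M)%:R /\ forall f psi, F f -> z psi = 0 ->
      sqnorm (dotmx psi (bits_state f)) ^+ D <= K psi * overlap_moment D (bits_state f)].
Proof.
move=> /overlap_exp_span[I [H [IM LH HP]]].
pose h (j : I + I) psi := match j with
  | inl i => Rec (H i psi) | inr i => Imc (H i psi) end.
have Lh j : sphere_bounded (h j) by case: j => i /=; case: (LH i).
have [K [z [LKz K0 z0 Iz [IK Kh]]]] := christoffel_fin sphere_functional Lh.
exists K, z; split=> //; split.
  by rewrite (le_trans IK)// ler_nat card_sum addnn mul2n leq_double.
move=> f psi /HP[c cP] zpsi.
pose a (j : I + I) := match j with inl i => Rec (c i) | inr i => - Imc (c i) end.
pose b (j : I + I) := match j with inl i => Imc (c i) | inr i => Rec (c i) end.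
have aE x : Rec (dotmx x (bits_state f) ^+ D) = \sum_j a j * h j x.
  rewrite cP (big_morph _ (@complex_ReD R) (erefl : Rec 0 = 0)) big_sumType /=.
  rewrite -big_split /=; apply: eq_bigr => i _.
  by rewrite complex_ReM mulN1r mulNr.
have bE x : Imc (dotmx x (bits_state f) ^+ D) = \sum_j b j * h j x.
  rewrite cP (big_morph _ (@complex_ImD R) (erefl : Imc 0 = 0)) big_sumType /=.
  rewrite -big_split /=; apply: eq_bigr => i _.
  by rewrite complex_ImM addrC.
have sqE x : sqnorm (dotmx x (bits_state f)) ^+ D =
    (\sum_j a j * h j x) ^+ 2 + (\sum_j b j * h j x) ^+ 2.
  by rewrite -sqnormX /sqnorm aE bE -!expr2.
have Lsum (e : I + I -> R) : sphere_bounded (fun x => (\sum_j e j * h j x) ^+ 2).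
  apply: (fa_exp fun_algebra_sphere_bounded).
  apply: (fa_sum _ _ sphere_functional) => j.
  exact: (pf_closedZ sphere_functional).
have -> : overlap_moment D (bits_state f) =
    sphere_integral (fun x => (\sum_j a j * h j x) ^+ 2) +
    sphere_integral (fun x => (\sum_j b j * h j x) ^+ 2).
  apply: (etrans _ (pf_D sphere_functional (Lsum a) (Lsum b))).
  apply: (congr1 sphere_integral).
  by apply/funext => x; exact: sqE.
by rewrite sqE mulrDr; apply: lerD; exact: Kh.
Qed.

Lemma sphere_markov (K : qstate_borel R n -> R) (a b : R) : sphere_bounded K ->
  (forall psi, 0 <= K psi) -> sphere_integral K <= b -> 0 < a ->
  (P (sphere `&` [set psi | (a <= K psi)%R]) <= (b / a)%:E)%E.
Proof.
move=> LK K0 Kb a0; have mS := measurable_sphere.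
have iK := sphere_bounded_integrable LK.
have mK : measurable_fun sphere (EFin \o K) by exact: (measurable_int P iK).
have := @le_integral_comp_abse _ _ R P sphere mS (EFin \o K) a id
  (@measurable_id _ _ setT) (fun r h => h) (fun x y _ _ xy => xy) mK a0.
have -> : (\int[P]_(x in sphere) `|(EFin \o K) x|)%E = (sphere_integral K)%:E.
  rewrite /sphere_integral /Rintegral fineK; last exact: (integrable_fin_num mS iK).
  by apply: eq_integral => x _ /=; rewrite ger0_norm.
rewrite /= => H.
have KE : [set x | (a%:E <= `|(K x)%:E|)%E] = [set psi | a <= K psi].
  by apply/seteqP; split => x /=; rewrite lee_fin ger0_norm.
move: H; rewrite KE => H.
rewrite -(@lee_pmul2l _ a%:E)//; apply: (le_trans H).
by rewrite -EFinM lee_fin mulrC divfK ?gt_eqF.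
Qed.

Lemma overlap_tail (D M : nat) (F : (bits n -> R[i]) -> Prop) (kappa : R)
    (A : set (qstate_borel R n)) :
  rank_le D M F -> (0 < D)%N -> 0 < kappa -> measurable A ->
  (forall psi, A psi -> exists f, [/\ F f, dotmx (bits_state f) (bits_state f) = 1 &
     kappa <= sqnorm (dotmx psi (bits_state f))]) ->
  (P A <= ((2 * M)%:R * (4 * (8 * expR 2 * D%:R / N%:R) ^+ D) / kappa ^+ D)%:E)%E.
Proof.
move=> rF D0 k0 mA AP; have mS := measurable_sphere.
have [K [z [[LK Lz] K0 z0 Iz [IK KP]]]] := overlap_kernel rF.
set beta := 4 * _ ^+ D.
have beta0 : 0 < beta.
  rewrite mulr_gt0// exprn_gt0// divr_gt0 ?mulr_gt0 ?expR_gt0 ?ltr0n//.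
  exact: N_gt0.
pose a := kappa ^+ D / beta.
have a0 : 0 < a by rewrite divr_gt0// exprn_gt0.
rewrite (_ : _ / _ = (2 * M)%:R / a); last first.
  by rewrite /a invf_div [RHS]mulrA.
apply: le_trans (sphere_markov LK K0 IK a0).
have iz := sphere_bounded_integrable Lz.
have mz : measurable_fun sphere (EFin \o z) by exact: (measurable_int P iz).
have : (\int[P]_(x in sphere) `|(EFin \o z) x| = 0)%E.
  rewrite -[RHS]/(0%:E) -Iz /sphere_integral /Rintegral fineK.
    by apply: eq_integral => x _ /=; rewrite ger0_norm.
  exact: (integrable_fin_num mS iz).
move=> /(ae_eq_integral_abs P mS mz).1 [Z [mZ PZ zZ]].
have [PS _] := haarP.
have mSc : measurable (~` sphere) by exact: measurableC.
have PSc : P (~` sphere) = 0%E.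
  have -> : (P (~` sphere) = 1 - P sphere)%E by rewrite probability_setC.
  by rewrite PS subee.
have mK : measurable (sphere `&` [set psi | a <= K psi]).
  have [mK _] := LK.
  apply: measurableI => //.
  rewrite -[X in measurable X]setTI.
  have -> : [set psi | a <= K psi] = K @^-1` `[a, +oo[%classic.
    by apply/seteqP; split => x /=; rewrite in_itv /= andbT.
  exact: mK.
(* Off the null sets, the kernel inequality and the moment bound beta give kappa^D <= K(psi) beta,
   so Markov's inequality at level a = kappa^D / beta applies. *)
have sub : A `<=` (sphere `&` [set psi | a <= K psi]) `|` ((~` sphere) `|` Z).
  move=> psi Apsi; have [Spsi|] := pselect (sphere psi); last by right; left.
  have [zpsi|zpsi] := pselect (z psi = 0); last first.
    right; right; apply: zZ => /= /(_ Spsi) []; exact: zpsi.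
  left; split=> //=; have [f [Ff f1 kf]] := AP psi Apsi.
  rewrite /a ler_pdivrMr//; apply: (@le_trans _ _ (sqnorm (dotmx psi (bits_state f)) ^+ D)).
    by apply: lerXn2r; rewrite ?nnegrE ?sqnorm_ge0// ltW.
  apply: (le_trans (KP f psi Ff zpsi)).
  by apply: ler_wpM2l => //; exact: overlap_moment_le.
have mSZ : measurable ((~` sphere) `|` Z) by exact: measurableU.
apply: (@le_trans _ _ (P ((sphere `&` [set psi | a <= K psi]) `|` ((~` sphere) `|` Z)))).
  by apply: le_measure; rewrite ?inE//; exact: measurableU.
rewrite measureU0//.
apply/eqP; rewrite eq_le measure_ge0 andbT.
apply: (@le_trans _ _ (P (~` sphere) + P Z)%E); first exact: measureU2.
by rewrite PSc PZ adde0.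
Qed.

End Haar.

(** * Measurability of the tree size *)

Section QTreeMap.
Variables (n : nat).

(** A [qtree nat n] serves as the shape of a tree, its labels being indices of variables for which
    [qmap] substitutes complex numbers. *)
Fixpoint qmap (A B : Type) (f : A -> B) (t : qtree A n) : qtree B n :=
  match t with
  | Leaf i a b => Leaf i (f a) (f b)
  | Plus Q cs => Plus Q [seq (f c.1, qmap f c.2) | c <- cs]
  | Tensor Q ts => Tensor Q [seq qmap f t | t <- ts]
  end.

Fixpoint labels (A : Type) (t : qtree A n) : seq A :=
  match t with
  | Leaf i a b => [:: a; b]
  | Plus Q cs => flatten [seq c.1 :: labels c.2 | c <- cs]
  | Tensor Q ts => flatten [seq labels t | t <- ts]
  end.

Lemma qmapK (A : eqType) (B : Type) (f : A -> B) (g : B -> A) (t : qtree A n) :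
  {in labels t, cancel f g} -> qmap g (qmap f t) = t.
Proof.
elim/qtree_ind_nested: t => [i a b|Q cs|Q ts] /=.
- by move=> fgK; rewrite !fgK ?inE ?eqxx ?orbT.
- move=> IH fgK; congr Plus; elim: cs IH fgK => // -[c t] cs IHcs /= [IHt IH] fgK.
  rewrite fgK ?mem_head// IHt; last first.
    by move=> x xt; apply: fgK; rewrite inE mem_cat xt orbT.
  congr cons; apply: IHcs => // x xcs; apply: fgK.
  by rewrite inE mem_cat xcs !orbT.
- move=> IH fgK; congr Tensor; elim: ts IH fgK => // t ts IHts /= [IHt IH] fgK.
  rewrite IHt; last by move=> x xt; apply: fgK; rewrite mem_cat xt.
  by congr cons; apply: IHts => // x xts; apply: fgK; rewrite mem_cat xts orbT.
Qed.

(** Two relabellings are compared because [qubits] takes trees over a field, not the shape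
    itself. *)
Lemma qubits_qmap (A : Type) (C : numClosedFieldType) (f g : A -> C) t :
  qubits (qmap f t) = qubits (qmap g t).
Proof. by case: t. Qed.

(** An encoding into a countable type. Tags 0, 1, 2 distinguish the vertices, and an edge label
    becomes the tag of a unary node. *)
Fixpoint qtree_code (t : qtree nat n) : GenTree.tree nat :=
  match t with
  | Leaf i a b => GenTree.Node 0 [:: GenTree.Leaf (i : nat); GenTree.Leaf a; GenTree.Leaf b]
  | Plus Q cs => GenTree.Node 1 (GenTree.Leaf (pickle Q) ::
      [seq GenTree.Node c.1 [:: qtree_code c.2] | c <- cs])
  | Tensor Q ts => GenTree.Node 2 (GenTree.Leaf (pickle Q) :: [seq qtree_code t | t <- ts])
  end.

Lemma qtree_code_inj : injective qtree_code.
Proof.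
elim/qtree_ind_nested => [i a b|Q cs IH|Q ts IH] [i' a' b'|Q' cs'|Q' ts'] //=.
- by move=> [/val_inj -> -> ->].
- move=> [/(pcan_inj pickleK) -> E]; congr Plus.
  elim: cs cs' IH E => [|[a t] cs IHcs] [|[a' t'] cs'] //= [IHt IH] [-> /IHt -> E].
  by congr cons; exact: IHcs.
- move=> [/(pcan_inj pickleK) -> E]; congr Tensor.
  elim: ts ts' IH E => [|t ts IHts] [|t' ts'] //= [IHt IH] [/IHt -> E].
  by congr cons; exact: IHts.
Qed.

End QTreeMap.

Lemma tree_size_qmap (A : Type) (C : numClosedFieldType) n (f g : A -> C)
  (t : qtree A n) : tree_size (qmap f t) = tree_size (qmap g t).
Proof.
elim/qtree_ind_nested: t => [//|Q cs|Q ts] /=.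
- by elim: cs => // c cs IHcs /= [-> /IHcs ->].
- by elim: ts => // c ts IHts /= [-> /IHts ->].
Qed.

Lemma measurable_bigcup_code d (T : measurableType d) (J : Type) (code : J -> nat)
    (B : J -> set T) : injective code -> (forall j, measurable (B j)) ->
  measurable [set x | exists j, B j x].
Proof.
move=> code_inj mB.
have -> : [set x | exists j, B j x] =
    \bigcup_k [set x | exists2 j, code j = k & B j x].
  apply/seteqP; split => x /=; first by move=> [j Bj]; exists (code j) => //; exists j.
  by move=> [k _ [j _ Bj]]; exists j.
apply: bigcupT_measurable => k.
have [[j jk]|nok] := pselect (exists j, code j = k).
- rewrite (_ : [set x | _] = B j)//; apply/seteqP; split => x /=; last by exists j.
  by move=> [j']; rewrite -jk => /code_inj ->.
- rewrite (_ : [set x | _] = set0)//; apply/seteqP; split => x //= [j jk _].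
  by apply: nok; exists j.
Qed.

Section TreeSpace.
Variables (R : realType) (n : nat).
Let N := #|bits n|.
(** Real and imaginary parts of countably many variables, so that one space serves all shapes; in
    the product topology boxes are compact. *)
Let X := prod_topology (fun _ : nat * bool => R : topologicalType).
Let Y := ('rV[R[i]^o]_N * X)%type.
Let cont := (fun f : Y -> R => continuous f).
Let contA : fun_algebra cont := @fun_algebra_continuous R Y.

Definition label_val (f : X) (k : nat) : R[i] := (f (k, false) +i* f (k, true))%C.

Lemma cx_label k : complexified cont (fun p => label_val p.2 k).
Proof.
have c b : continuous (fun p : Y => p.2 (k, b)).
  move=> p; apply: (@continuous_comp Y X R snd (fun f : X => f (k, b))).
    exact: cvg_snd.
  exact: (@proj_continuous _ (fun=> R : topologicalType) (k, b)).
by split; exact: c.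
Qed.

Lemma cx_psi j : complexified cont (fun p => p.1 0 j).
Proof.
have [c1 c2] := complexified_coord R j.
split=> p.
- apply: (@continuous_comp Y _ R fst (fun u : 'rV[R[i]^o]_N => Rec (u 0 j))).
    exact: cvg_fst.
  exact: c1.
- apply: (@continuous_comp Y _ R fst (fun u : 'rV[R[i]^o]_N => Imc (u 0 j))).
    exact: cvg_fst.
  exact: c2.
Qed.

Lemma cx_amplitude (t : qtree nat n) x :
  complexified cont (fun p => amplitude (qmap (label_val p.2) t) x).
Proof.
elim/qtree_ind_nested: t => [i a b|Q cs|Q ts] /=.
- by case: (x i); exact: cx_label.
- elim: cs => [_|c cs IHcs /= [cc /IHcs ccs]].
    by under eq_fun do rewrite big_nil; exact: (cx_cst contA).
  under eq_fun do rewrite big_cons.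
  by apply: (cx_D contA) => //; apply: (cx_M contA) => //; exact: cx_label.
- elim: ts => [_|c ts IHts /= [cc /IHts cts]].
    by under eq_fun do rewrite big_nil; exact: (cx_cst contA).
  under eq_fun do rewrite big_cons.
  exact: (cx_M contA).
Qed.

Lemma closed_normalized (t : qtree nat n) :
  closed [set p : Y | normalized (qmap (label_val p.2) t)].
Proof.
pose b (x : bits n) := [forall i, x i ==> (i \in qubits (qmap (fun=> 0 : R[i]) t))].
pose s (p : Y) : R := \sum_(x <- index_enum (bits n))
  (if b x then sqnorm (amplitude (qmap (label_val p.2) t) x) else 0).
have cs : cont s.
  apply: (fa_sum _ _ contA) => x; case: (b x); last exact: (fa_cst contA).
  exact: (cx_sqnorm contA (cx_amplitude t x)).
have -> : [set p : Y | normalized (qmap (label_val p.2) t)] = s @^-1` [set 1].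
  have sE p : \sum_(x : bits n | b x)
      `|amplitude (qmap (label_val p.2) t) x| ^+ 2 = ((s p)%:C)%C.
    rewrite (eq_bigr (fun x => ((sqnorm (amplitude (qmap (label_val p.2) t) x))%:C)%C)).
      by rewrite -rmorph_sum /s [in LHS]big_mkcond.
    by move=> x _; rewrite sqnormE.
  apply/seteqP; split => p /=; rewrite /normalized (qubits_qmap _ (fun=> 0)) sE.
  - by move=> /eqP/complexI.
  - by move=> ->.
apply: (@closed_comp Y R) => [p _|]; first exact: cs.
exact: closed_eq.
Qed.

Lemma closed_andb (Q1 Q2 : Y -> bool) : closed [set p | Q1 p] ->
  closed [set p | Q2 p] -> closed [set p | Q1 p && Q2 p].
Proof.
move=> c1 c2.
have -> : [set p | Q1 p && Q2 p] = [set p | Q1 p] `&` [set p | Q2 p].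
  by apply/seteqP; split => p /= /andP.
exact: closedI.
Qed.

Lemma closed_cstb (b : bool) : closed [set _ : Y | b].
Proof.
case: b.
  rewrite (_ : [set _ | _] = setT); first exact: closedT.
  by apply/seteqP; split.
rewrite (_ : [set _ | _] = set0); first exact: closed0.
by apply/seteqP; split.
Qed.

(** The combinatorial conditions depend on the shape alone; the labels enter only through the
    normalizations, which are polynomial equations. *)
Lemma closed_valid (t : qtree nat n) : closed [set p : Y | valid (qmap (label_val p.2) t)].
Proof.
elim/qtree_ind_nested: t => [i a b|Q cs IH|Q ts IH].
- exact: (closed_andb (@closed_normalized (Leaf i a b)) (@closed_cstb true)).
- apply: (closed_andb (@closed_normalized (Plus Q cs))).
  apply: closed_andb.
    by under eq_set do rewrite size_map; exact: closed_cstb.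
  apply: closed_andb.
    have E p : all (fun c : R[i] * qtree R[i] n => qubits c.2 == Q)
        [seq (label_val p c.1, qmap (label_val p) c.2) | c <- cs] =
        all (fun c => qubits (qmap (fun=> 0 : R[i]) c.2) == Q) cs.
      by rewrite all_map; apply: eq_all => c /=; rewrite (qubits_qmap _ (fun=> 0)).
    by under eq_set do rewrite E; exact: closed_cstb.
  elim: cs IH => [_|c cs IHcs /= [cc /IHcs ccs]]; first exact: closed_cstb.
  exact: closed_andb.
- have E p : [seq qubits c | c <- [seq qmap (label_val p) t | t <- ts]] =
      [seq qubits (qmap (fun=> 0 : R[i]) t) | t <- ts].
    by rewrite -map_comp; apply: eq_map => t /=; exact: qubits_qmap.
  apply: (closed_andb (@closed_normalized (Tensor Q ts))).
  apply: closed_andb.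
    by under eq_set do rewrite size_map; exact: closed_cstb.
  apply: closed_andb; first by under eq_set do rewrite E; exact: closed_cstb.
  apply: closed_andb; first by under eq_set do rewrite E; exact: closed_cstb.
  elim: ts IH {E} => [_|c ts IHts /= [cc /IHts ccs]]; first exact: closed_cstb.
  exact: closed_andb.
Qed.

Definition good_tree (a : R) (psi : qstate R n) (t : qtree R[i] n) : bool :=
  quantum_state_tree t && ((a%:C)%C <= `|dotmx psi (tree_state t)| ^+ 2).

Lemma closed_good_tree a (t : qtree nat n) :
  closed [set p : Y | good_tree a p.1 (qmap (label_val p.2) t)].
Proof.
apply: closed_andb.
  apply: closed_andb; last exact: closed_valid.
  by under eq_set do rewrite (qubits_qmap _ (fun=> 0)); exact: closed_cstb.
pose s (p : Y) : R := sqnorm (dotmx p.1 (tree_state (qmap (label_val p.2) t))).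
have cs : cont s.
  apply: (cx_sqnorm contA).
  under eq_fun do rewrite dotmx_sum.
  apply: (cx_sum contA) => j; apply: (cx_M contA); first exact: cx_psi.
  apply: (cx_conj contA); under eq_fun do rewrite mxE.
  exact: cx_amplitude.
under eq_set do rewrite -sqnormE lecR.
apply: (@closed_comp Y R s [set y | a <= y]) => [p _|]; first exact: cs.
exact: closed_ge.
Qed.

Definition label_box (m : nat) : set X :=
  [set f | forall k : nat * bool, `[- m%:R, m%:R]%classic (f k)].

Lemma compact_label_box m : compact (label_box m).
Proof.
apply: (@tychonoff _ (fun=> R : topologicalType) (fun=> `[- m%:R, m%:R]%classic)) => k.
exact: segment_compact.
Qed.

(** Tube lemma: for psi outside the set, each f in the box has a neighbourhood that, with some
    neighbourhood of psi, avoids the closed set of good pairs; compactness gives one neighbourhood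
    of psi for the whole box. *)
Lemma closed_good_state a (t : qtree nat n) m :
  closed [set psi : 'rV[R[i]^o]_N |
    exists2 f, label_box m f & good_tree a psi (qmap (label_val f) t)].
Proof.
set E := [set _ | _]; rewrite -[E]setCK; apply: open_closedC.
rewrite openE => psi nE; rewrite /interior.
have nbad (f : X) : label_box m f -> \forall f' \near f & psi' \near psi,
    ~ good_tree a psi' (qmap (label_val f') t).
  move=> bf; pose G := [set p : Y | good_tree a p.1 (qmap (label_val p.2) t)].
  have oG : open (~` G) by apply: closed_openC; exact: closed_good_tree.
  have nG : (~` G) (psi, f) by move=> g; apply: nE; exists f.
  have : nbhs (psi, f) (~` G) by apply: open_nbhs_nbhs; split.
  move=> [[U V] /= [psiU fV] UV]; exists (V, U); first by split.
  move=> [f' psi'] [Vf' Upsi'].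
  exact: (UV (psi', f') (conj Upsi' Vf')).
have H := (compact_near_coveringP (label_box m)).1 (@compact_label_box m) _ (nbhs psi)
  (fun psi' f' => ~ good_tree a psi' (qmap (label_val f') t)) _ nbad.
apply: (@filterS _ (nbhs psi) _ _ _ _ (H (nbhs_filter psi))) => psi' h [f bf gf].
exact: (h f bf gf).
Qed.

End TreeSpace.

Lemma closed_measurable_qstate (R : realType) n (A : set 'rV[R[i]^o]_#|bits n|) :
  closed A -> measurable (A : set (qstate_borel R n)).
Proof.
move=> cA; rewrite -[A]setCK; apply: measurableC.
by apply: sub_sigma_algebra; exact: closed_openC.
Qed.

(* Each tree is a shape with finitely many complex labels, and the shapes are
   countable. For a fixed shape and labels in a fixed compact box, the states
   approximated by the tree form a closed set, as the projection of a closed set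
   along a compact space; hence the sublevel sets of TS are F_sigma. *)
Lemma measurable_TS (R : realType) n (eps b : R) :
  measurable [set psi : qstate_borel R n | (b%:E <= TS eps psi)%E].
Proof.
pose B (k : qtree nat n * nat) : set (qstate_borel R n) := [set psi |
  ((tree_size (qmap (fun=> 0 : R[i]) k.1))%:R < b) /\
  exists2 f, @label_box R k.2 f & good_tree (1 - eps) psi (qmap (label_val f) k.1)].
have mB k : measurable (B k).
  have [sb|sb] := boolP ((tree_size (qmap (fun=> 0 : R[i]) k.1))%:R < b).
    rewrite (_ : B k = [set psi | exists2 f, @label_box R k.2 f &
        good_tree (1 - eps) psi (qmap (label_val f) k.1)]).
      by apply: closed_measurable_qstate; exact: closed_good_state.
    by apply/seteqP; split => psi //= -[].
  by rewrite (_ : B k = set0)//; apply/seteqP; split => psi //= [/(negP sb)].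
have := measurableC (@measurable_bigcup_code _ _ _
  (fun k : qtree nat n * nat => pickle (qtree_code k.1, k.2)) B _ mB).
rewrite (_ : ~` _ = [set psi : qstate_borel R n | (b%:E <= TS eps psi)%E]).
  apply=> -[t m] [t' m'] /(pcan_inj pickleK)[] /qtree_code_inj -> ->//.
apply/seteqP; split => psi /=; last first.
  move=> bT [[t m] [/= tb [f _ /andP[qt ft]]]].
  have : (TS eps psi <= (tree_size (qmap (label_val f) t))%:R%:E)%E.
    by apply: ereal_inf_lbound; exists (qmap (label_val f) t).
  move=> /(le_trans bT); rewrite lee_fin leNgt => /negP; apply.
  by rewrite (tree_size_qmap _ (fun=> 0)).
move=> nB; apply: le_ereal_inf_tmp => _ [t [qt ft] <-]; rewrite lee_fin leNgt.
apply/negP => tb; apply: nB.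
(* The shape of t replaces each label by its first position in l. Variables beyond l take the
   default 0, which lies in every box. *)
pose l := labels t; pose lab (k : nat * bool) : R :=
  if k.2 then Imc (nth 0 l k.1) else Rec (nth 0 l k.1).
pose s : R := \sum_(z <- l) (`|Rec z| + `|Imc z|).
pose m := (Num.truncn s).+1.
have sm : s <= m%:R by apply/ltW; exact: truncnS_gt.
have labE k : label_val lab k = nth 0 l k by rewrite /label_val /lab /=; case: (nth _ _ _).
have tE : qmap (label_val lab) (qmap (index^~ l) t) = t.
  by apply: qmapK => z zl; rewrite labE nth_index.
exists (qmap (index^~ l) t, m); split => /=.
  by rewrite (tree_size_qmap _ (label_val lab)) tE.
exists lab; last by rewrite tE /good_tree qt.
have bnd z : z \in l -> `|Rec z| + `|Imc z| <= m%:R.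
  move=> zl; apply: le_trans sm; rewrite /s (big_rem z)//= lerDl.
  by apply: sumr_ge0 => w _; rewrite addr_ge0.
move=> [k c]; rewrite /lab /= in_itv /= -ler_norml.
have [kl|kl] := ltnP k (size l).
  have := bnd _ (mem_nth 0 kl); case: c; apply: le_trans.
    by rewrite lerDr.
  by rewrite lerDl.
by rewrite nth_default//; case: c; rewrite normr0.
Qed.

(** * The tail bound *)

Lemma tree_state_unit (R : realType) n (t : qtree R[i] n) : quantum_state_tree t ->
  dotmx (tree_state t) (tree_state t) = 1.
Proof.
move=> /andP[/eqP qt vt].
have : normalized t by case: t vt {qt} => [i a b|Q cs|Q ts] /andP[].
rewrite /normalized qt => /eqP nt; rewrite -[RHS]nt dotmx_sum.
rewrite (reindex (@enum_val _ (bits n))) /=; last first.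
  by apply: onW_bij; exact: enum_val_bij.
apply: eq_big => [j|j _]; last by rewrite mxE normCK.
by apply/esym/forallP => i; rewrite inE implybT.
Qed.

(** The union over at most S sizes is paid for by one more factor of the base, which is at least
    S. *)
Lemma formula_rank_union (C : comNzRingType) (n D S : nat) : (0 < S)%N ->
  rank_le D (((n + S) * D.+2) ^ S.*2)
    (fun f => exists2 s, (s <= S)%N & @formula C n s f).
Proof.
move=> S0; set B := ((n + S) * D.+2)%N.
apply: (@rank_leW _ _ _ (S * B ^ (S.*2.-1)) _ _
   (fun f => exists2 s, (s < S)%N & @formula C n s.+1 f)).
- rewrite -[in leqRHS](prednK (n := S.*2)) ?double_gt0// expnS leq_mul2r.
  by rewrite /B mulnDl mulnS; apply/orP; right; lia.
- move=> f [s sS Ff]; have := formula_gt0 Ff; exists s.-1; first by lia.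
  by rewrite prednK.
- apply: rank_le_bigU => s sS.
  apply: rank_leW (leqnn _) _ (rank_leW _ (fun f Ff => Ff)
    (formula_rank C n D (S := S) (s := s.+1) _)) => //.
  by rewrite -/B leq_pexp2l//; rewrite /B; lia.
Qed.

(** The base is at most 2^(5q + 5), and (5q + 5) 2^(q + 1) <= 2^(2q + 4) <= 2^(4q); the last
    inequality is where q >= 2 is needed. *)
Lemma rank_bound (n q : nat) : (2 <= q)%N -> (n < 8 * q.+1)%N ->
  (((n + 2 ^ q) * (2 ^ (4 * q)).+2) ^ (2 ^ q).*2 <= 2 ^ (2 ^ (4 * q)))%N.
Proof.
move=> q2 nq.
have q1 : (q.+1 <= 2 ^ q)%N by exact: ltn_expl.
have h1 : (n + 2 ^ q <= 2 ^ (q + 4))%N by rewrite expnD; lia.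
have h2 : ((2 ^ (4 * q)).+2 <= 2 ^ (4 * q + 1))%N.
  rewrite expnD.
  have : (2 ^ 1 <= 2 ^ (4 * q))%N by rewrite leq_exp2l//; lia.
  by lia.
apply: (@leq_trans ((2 ^ (5 * q + 5)) ^ (2 ^ q).*2)).
  rewrite leq_exp2r; last by rewrite double_gt0 expn_gt0.
  by rewrite (_ : 5 * q + 5 = (q + 4) + (4 * q + 1))%N ?[X in (_ <= X)%N]expnD ?leq_mul//; lia.
rewrite -expnM leq_exp2l//.
apply: (@leq_trans (2 ^ (q + 4) * 2 ^ q)).
  by rewrite -mul2n mulnA leq_mul2r expnD; apply/orP; right; lia.
by rewrite -expnD leq_exp2l//; lia.
Qed.

Section Tail.
Variables (R : realType) (n : nat) (P : probability (qstate_borel R n) R).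
Hypothesis haarP : haar_measure P.

(** Here q is n / 8 rounded down, S = 2^q and D = 2^(4q), so that 2^n >= D 2^(4q). The last
    hypothesis brings the base of the moment, divided by the fidelity 15/16, below 1/4, against a
    rank of at most 2^D. *)
Lemma TS_tail (q : nat) : (2 <= q)%N -> (8 * q <= n < 8 * q.+1)%N ->
  4 * (8 * expR 2 * (16 / 15)) <= 2 ^+ (4 * q) :> R ->
  (P (~` [set psi | ((2 `^ (1 / 16 * n%:R))%:E <= TS (1 / 16) psi)%E]) <=
     (8 * 2^-1 ^+ q)%:E)%E.
Proof.
move=> q2 /andP[qn nq] Cq.
set S := (2 ^ q)%N; set D := (2 ^ (4 * q))%N.
have S0 : (0 < S)%N by rewrite expn_gt0.
have D0 : (0 < D)%N by rewrite expn_gt0.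
have rF := @formula_rank_union R[i] n D S S0.
have mA : measurable (~` [set psi : qstate_borel R n |
    ((2 `^ (1 / 16 * n%:R))%:E <= TS (1 / 16) psi)%E]).
  by apply: measurableC; exact: measurable_TS.
have k0 : 0 < 15 / 16 :> R by lra.
(* The exponent n / 16 is at most q, because n < 8 (q + 1) <= 16 q. *)
have sizeS (s : nat) : s%:R < 2 `^ (1 / 16 * n%:R) :> R -> (s <= S)%N.
  move=> sn; rewrite -(ler_nat R) (le_trans (ltW sn))// /S natrX -powR_mulrn//.
  apply: ler_powR; first by rewrite ler1n.
  rewrite mulrAC mul1r ler_pdivrMr// -natrM ler_nat; lia.
apply: le_trans (overlap_tail haarP rF D0 k0 mA _) _.
  move=> psi /= /negP; rewrite -ltNge => /ereal_inf_lt[_ [t [qt ft] <-]].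
  rewrite lte_fin => /sizeS tS.
  exists (amplitude t); split.
  - exists (tree_size t) => //; apply: formula_amplitude.
    by case/andP: qt.
  - exact: tree_state_unit.
  - have {ft} : 1 - 1 / 16 <= sqnorm (dotmx psi (tree_state t)).
      by move: ft; rewrite -sqnormE lecR.
    by apply: le_trans; lra.
rewrite lee_fin card_ffun card_bool card_ord.
have N0 : 0 < (2 ^ n)%:R :> R by rewrite ltr0n expn_gt0.
have DN : D%:R * 2 ^+ (4 * q) <= (2 ^ n)%:R :> R.
  by rewrite -natrX -natrM ler_nat -expnD leq_exp2l//; lia.
have e0 := expR_gt0 (2 : R).
have Dp : 0 < D%:R :> R by rewrite ltr0n.
have base : 8 * expR 2 * D%:R / (2 ^ n)%:R / (15 / 16) <= 4^-1 :> R.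
  rewrite ler_pdivrMr; last by lra.
  rewrite ler_pdivrMr//.
  have : 4 * (8 * expR 2 * (16 / 15)) * D%:R <= 2 ^+ (4 * q) * D%:R :> R.
    by apply: ler_wpM2r => //; exact: ltW.
  move: DN; rewrite [D%:R * _]mulrC.
  by move: (2 ^+ (4 * q) * D%:R) => w; lra.
have powD : (8 * expR 2 * D%:R / (2 ^ n)%:R) ^+ D / (15 / 16) ^+ D <= 4^-1 ^+ D :> R.
  rewrite -expr_div_n; apply: lerXn2r; last exact: base.
    by rewrite nnegrE !mulr_ge0 ?invr_ge0 ?expR_ge0.
  by rewrite nnegrE invr_ge0.
have rankD : (((n + S) * D.+2) ^ S.*2)%:R <= 2 ^+ D :> R.
  by rewrite -natrX ler_nat; exact: rank_bound.
(* The bound 8 * 2^-D is weakened to 8 * 2^-q, which is enough for the limit. *)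
have qD : (q <= D)%N.
  by apply: (@leq_trans (2 ^ q)); rewrite ?leq_exp2l ?leq_pmull// ltnW// ltn_expl.
move: powD; set x := _ ^+ D / _ => xD.
have -> : (2 * ((n + S) * D.+2) ^ S.*2)%:R *
    (4 * (8 * expR 2 * D%:R / (2 ^ n)%:R) ^+ D) / (15 / 16) ^+ D =
    8 * ((((n + S) * D.+2) ^ S.*2)%:R * x) :> R.
  rewrite natrM /x; set r := (_ ^ _)%N; move: (r%:R : R) (_ ^+ D) (_ ^+ D)^-1 => u v w.
  by ring.
rewrite ler_pM2l//; apply: (@le_trans _ _ (2 ^+ D * 4^-1 ^+ D)).
  apply: ler_pM => //.
  by rewrite /x divr_ge0 ?exprn_ge0 ?divr_ge0 ?mulr_ge0 ?expR_ge0 ?ler0n.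
rewrite -exprMn (_ : 2 * 4^-1 = 2^-1); last by lra.
by apply: ler_wiXn2l => //; lra.
Qed.
End Tail.

Theorem theorem7 (R : realType) :
  exists2 c : R, 0 < c &
    forall P : forall n : nat, probability (qstate_borel R n) R,
      (forall n, haar_measure (P n)) ->
      P n [set psi | ((2 `^ (c * n%:R))%:E <= TS (1 / 16) psi)%E]
        @[n --> \oo] --> 1%E.
Proof.
exists (1 / 16) => [|P haarP]; first by lra.
have div8 : (n %/ 8)%N @[n --> \oo] --> \oo.
  apply/cvgnyPge => k; exists (8 * k)%N => // n /= kn.
  by rewrite leq_divRL// mulnC.
apply: (@squeeze_cvge _ _ _ _ (fun n => (1 - 8 * 2^-1 ^+ (n %/ 8)%N : R)%:E)
  _ (fun=> 1%E)).
- pose C : R := 4 * (8 * expR 2 * (16 / 15)).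
  have C0 : 0 <= C by rewrite /C !mulr_ge0 ?expR_ge0//; lra.
  near=> n.
  have q2 : (2 <= n %/ 8)%N by near: n; move/cvgnyPge : div8; exact.
  have Cq : C <= 2 ^+ (4 * (n %/ 8))%N.
    (* For large n the quotient exceeds C, and k <= 2^(4k) turns this into the hypothesis of
       [TS_tail]. *)
    have nC : ((Num.truncn C).+1 <= n %/ 8)%N by near: n; move/cvgnyPge : div8; exact.
    rewrite (le_trans (ltW (truncnS_gt C)))// -natrX ler_nat (leq_trans nC)//.
    by rewrite (leq_trans (ltnW (ltn_expl _ (ltnSn 1))))// leq_exp2l// leq_pmull.
  have qn : (8 * (n %/ 8) <= n < 8 * (n %/ 8).+1)%N.
    by rewrite mulnC leq_trunc_div mulnC -ltn_divLR// ltnSn.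
  pose A : set (qstate_borel R n) :=
    [set psi | ((2 `^ (1 / 16 * n%:R))%:E <= TS (1 / 16) psi)%E].
  have mA : measurable A by exact: measurable_TS.
  have tail : (P n (~` A) <= (8 * 2^-1 ^+ (n %/ 8))%:E)%E.
    exact: (TS_tail (haarP n) q2 qn Cq).
  have PA : (P n A = 1 - P n (~` A))%E.
    by rewrite -probability_setC ?setCK//; exact: measurableC.
  have PA1 : (P n A <= 1)%E by exact: probability_le1.
  suff : ((1 - 8 * 2^-1 ^+ (n %/ 8))%:E <= P n A)%E by move=> ->.
  by rewrite PA EFinB; apply: leeB.
- apply: cvg_EFin; first by near=> n.
  have h : (2^-1 : R) ^+ (n %/ 8) @[n --> \oo] --> (0 : R).
    apply: (cvg_comp _ _ div8); apply: cvg_expr.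
    by rewrite ger0_norm; lra.
  rewrite -[X in _ --> X](subr0 (1 : R)) -(mulr0 (8 : R)).
  by apply: cvgB; [exact: cvg_cst|apply: cvgM => //; exact: cvg_cst].
- exact: cvg_cst.
Unshelve. all: by end_near.
Qed.
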